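(* Let $\Upsilon=\Upsilon(\underline{\psi},\underline{\delta})$ be a triangular $\mathbf{t}$-module over $K$ with no nilpotence such that $r_l:=\operatorname{rk}\psi_l>1$ for $l=1,\dots,n$. If $\Upsilon$ allows for LD-biderivations, then $(\Upsilon^\vee)^\vee\cong\Upsilon$ over $K(\Upsilon)$, and there is an exact sequence of $\mathbf{t}$-modules over $K(\Upsilon)$ \[0\longrightarrow\Upsilon\longrightarrow\operatorname{Ext}^1_\tau(\Upsilon^\vee,C)\longrightarrow\mathbb G_a^s\longrightarrow0,\qquad s=\sum_{l=1}^n\operatorname{rk}\psi_l-n.\]
   Context: Let $A=\mathbb F_q[t]$, $K$ an $A$-field with $\theta$ the image of $t$, $L\{\tau\}$ the twisted polynomial ring over a field $L$ ($\tau c=c^q\tau$), $\partial$ the constant term. A $\mathbf{t}$-module of dimension $d$ is an $\mathbb F_q$-algebra homomorphism $\Phi:A\to\mathrm{Mat}_d(K\{\tau\})$ with $\partial\Phi_t=\theta I_d+N$, $N$ nilpotent; no nilpotence means $N=0$. Isomorphism over $L$: conjugation by an invertible matrix over $L\{\tau\}$. $C$: Carlitz module $C_t=\theta+\tau$; $\mathbb G_a^s$: $t\mapsto\theta I_s$. Drinfeld module: $\psi_t=\theta+a_1\tau+\dots+a_r\tau^r$, $a_r\ne0$, $\operatorname{rk}\psi=r$. Triangular $\mathbf{t}$-module $\Upsilon(\underline\psi,\underline\delta)$ of dimension $n$: with rows and columns indexed $n,\dots,1$ from top to bottom and left to right, $\Upsilon_t$ is lower triangular with diagonal entry $\psi_{k,t}$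 at $(k,k)$, entry $\delta_{i\times j}$ in row $i$, column $j$ ($i<j$), zeros elsewhere; $\delta_l=(\delta_{l\times l+1},\dots,\delta_{1\times l+1})^T$, $\deg_\tau\delta_l$ the maximal degree of its entries. Every triangular $\Upsilon$ is isomorphic over some finite extension $K(\Upsilon)$ of $K$ to a reduced form $\Upsilon(\underline\psi^{\mathrm{red}},\underline\delta^{\mathrm{red}})$ with $\deg_\tau\delta^{\mathrm{red}}_{i\times j}<\max\{\operatorname{rk}\psi_i,\operatorname{rk}\psi_j\}$ for $i<j$; $\Upsilon$ allows for LD-biderivations if its reduced form satisfies $\deg_\tau\delta^{\mathrm{red}}_l<\operatorname{rk}\psi_{l+1}$ for $l=1,\dots,n-1$. For $\mathbf{t}$-modules $\Phi$ (dim $d$), $\Psi$ (dim $e$): $\mathrm{Der}(\Phi,\Psi)\cong\mathrm{Mat}_{e\times d}(K\{\tau\})$, $\mathrm{Der}_{in}=\{U\Phi_t-\Psi_tU\}$, $\operatorname{Ext}^1_\tau(\Phi,\Psi)=\mathrm{Der}/\mathrm{Der}_{in}$ with $t*\delta=\Psi_t\delta$. The dual is $\Phi^\vee=\mathrm{Der}_0(\Phi,C)/\mathrm{Der}_{in,0}(\Phi,C)$ ($\mathrm{Der}_0$: zero constant term; $\mathrm{Der}_{in,0}=\mathrm{Der}_{in}\cap\mathrm{Der}_0$), with $t*\delta=C_t\delta$; under the hypotheses $\Upsilon^\vee$ and $\operatorname{Ext}^1_\tau(\Upsilon^\vee,C)$ carry natural $\mathbf{t}$-module structures (in coordinates of reduced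 representatives), $\Upsilon^\vee$ has no nilpotence, and $(\Upsilon^\vee)^\vee$ is the dual of the $\mathbf{t}$-module $\Upsilon^\vee$. *)

(* Defs.v *)
From HB Require Import structures.
From mathcomp Require Import all_boot all_order all_fingroup all_algebra all_solvable all_field.

Set Implicit Arguments.
Unset Strict Implicit.
Unset Printing Implicit Defensive.

Import GRing.Theory.
Local Open Scope ring_scope.

(* The carrier of R{tau} for a ring endomorphism s of R: a left coefficient
   sequence, read as the sum of the p`_i * tau ^+ i, with tau * c = s c * tau. *)
Record skewpoly (R : nzRingType) (s : {rmorphism R -> R}) : Type :=
  SkewPoly { skew_coefs :> {poly R} }.

Section SkewPoly.
Variables (R : nzRingType) (s : {rmorphism R -> R}).
Local Notation S := (skewpoly s).

HB.instance Definition _ := [isNew for @skew_coefs R s].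
HB.instance Definition _ := [Choice of S by <:].

Definition skew_add (p q : S) : S := SkewPoly s (skew_coefs p + skew_coefs q).
Definition skew_opp (p : S) : S := SkewPoly s (- skew_coefs p).
Definition skew_zero : S := SkewPoly s 0.

Lemma skewP (p q : S) : (forall i, p`_i = q`_i) -> p = q.
Proof. by case: p q => [p] [q] /= /polyP ->. Qed.

Fact skew_addA : associative skew_add.
Proof. by move=> p q r; apply: val_inj; rewrite /= addrA. Qed.
Fact skew_addC : commutative skew_add.
Proof. by move=> p q; apply: val_inj; rewrite /= addrC. Qed.
Fact skew_add0 : left_id skew_zero skew_add.
Proof. by move=> p; apply: val_inj; rewrite /= add0r. Qed.
Fact skew_addN : left_inverse skew_zero skew_opp skew_add.
Proof. by move=> p; apply: val_inj; rewrite /= addNr. Qed.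

HB.instance Definition _ :=
  GRing.isZmodule.Build S skew_addA skew_addC skew_add0 skew_addN.

Definition skew_one : S := SkewPoly s 1.
Definition skew_mul (p q : S) : S :=
  SkewPoly s
    (\poly_(k < size p + size q) \sum_(i < k.+1) p`_i * iter i s q`_(k - i)).

Lemma iter_morph0 i : iter i s 0 = 0.
Proof. by elim: i => //= i ->; rewrite rmorph0. Qed.
Lemma iter_morph1 i : iter i s 1 = 1.
Proof. by elim: i => //= i ->; rewrite rmorph1. Qed.
Lemma iter_morphD i x y : iter i s (x + y) = iter i s x + iter i s y.
Proof. by elim: i => //= i ->; rewrite rmorphD. Qed.
Lemma iter_morphM i x y : iter i s (x * y) = iter i s x * iter i s y.
Proof. by elim: i => //= i ->; rewrite rmorphM. Qed.
Lemma iter_morph_sum i (I : Type) (r : seq I) (P : pred I) (E : I -> R) :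
  iter i s (\sum_(k <- r | P k) E k) = \sum_(k <- r | P k) iter i s (E k).
Proof. by apply: (big_morph _ (iter_morphD i) (iter_morph0 i)). Qed.

Lemma coef_skew_mul p q k :
  (skew_mul p q)`_k = \sum_(i < k.+1) p`_i * iter i s q`_(k - i).
Proof.
rewrite coef_poly; case: ltnP => // le_pq_k; rewrite big1 // => i _.
have [le_p_i|lt_i_p] := leqP (size p) i; first by rewrite nth_default ?mul0r.
have le_q : (size q <= k - i)%N.
  rewrite leq_subRL ?leq_ord //; apply: leq_trans le_pq_k.
  by rewrite leq_add2r ltnW.
by rewrite (nth_default 0 le_q) iter_morph0 mulr0.
Qed.

Lemma coef_skew_mul_rev p q k :
  (skew_mul p q)`_k = \sum_(i < k.+1) p`_(k - i) * iter (k - i) s q`_i.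
Proof.
rewrite coef_skew_mul (reindex_inj rev_ord_inj) /=.
by apply: eq_bigr => i _; rewrite (sub_ordK i).
Qed.

Fact skew_mulA : associative skew_mul.
Proof.
move=> p q r; apply: skewP => i; rewrite coef_skew_mul coef_skew_mul_rev.
pose coef3 j k :=
  p`_j * (iter j s q`_(i - j - k) * iter (i - k) s r`_k).
transitivity (\sum_(j < i.+1) \sum_(k < i.+1 | (k <= i - j)%N) coef3 j k).
  apply: eq_bigr => /= j _.
  rewrite coef_skew_mul_rev iter_morph_sum big_distrr /=.
  rewrite (big_ord_narrow_leq (leq_subr _ _)); apply: eq_bigr => k _ /=.
  rewrite iter_morphM -iterD /coef3; congr (_ * (_ * iter _ _ _)).
  have le_j : (j <= i)%N by rewrite leq_ord.
  have le_k : (j + k <= i)%N by rewrite -leq_subRL // -ltnS.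
  rewrite -subnDA (addnC j k) subnDA subnKC // leq_subRL 1?addnC //.
  by apply: leq_trans le_k; apply: leq_addl.
rewrite (exchange_big_dep predT) //=; apply: eq_bigr => k _.
transitivity (\sum_(j < i.+1 | (j <= i - k)%N) coef3 j k).
  apply: eq_bigl => j; rewrite -ltnS -(ltnS j) -!subSn ?leq_ord //.
  by rewrite -subn_gt0 -(subn_gt0 j) -!subnDA addnC.
rewrite (big_ord_narrow_leq (leq_subr _ _)) coef_skew_mul big_distrl /=.
by apply: eq_bigr => j _; rewrite /coef3 -!subnDA addnC mulrA.
Qed.

Fact skew_mul1l : left_id skew_one skew_mul.
Proof.
move=> p; apply: skewP => k; rewrite coef_skew_mul big_ord_recl subn0 coef1 /=.
by rewrite mul1r big1 ?addr0 // => i _; rewrite coef1 mul0r.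
Qed.

Fact skew_mul1r : right_id skew_one skew_mul.
Proof.
move=> p; apply: skewP => k; rewrite coef_skew_mul_rev big_ord_recl subn0 coef1.
rewrite /= iter_morph1 mulr1 big1 ?addr0 // => i _.
by rewrite coef1 iter_morph0 mulr0.
Qed.

Fact skew_mulDl : left_distributive skew_mul +%R.
Proof.
move=> p q r; apply: skewP => k; rewrite coef_skew_mul [in RHS]coefD !coef_skew_mul -big_split /=.
by apply: eq_bigr => i _; rewrite coefD mulrDl.
Qed.

Fact skew_mulDr : right_distributive skew_mul +%R.
Proof.
move=> p q r; apply: skewP => k; rewrite coef_skew_mul [in RHS]coefD !coef_skew_mul -big_split /=.
by apply: eq_bigr => i _; rewrite coefD iter_morphD mulrDr.
Qed.

Fact skew_1neq0 : skew_one != 0.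
Proof. by rewrite -val_eqE /= oner_neq0. Qed.

HB.instance Definition _ := GRing.Zmodule_isNzRing.Build S
  skew_mulA skew_mul1l skew_mul1r skew_mulDl skew_mulDr skew_1neq0.

Lemma coef_skewM (p q : S) k :
  (p * q)`_k = \sum_(i < k.+1) p`_i * iter i s q`_(k - i).
Proof. exact: coef_skew_mul. Qed.

Lemma coef_skewD (p q : S) k : (p + q)`_k = p`_k + q`_k.
Proof. exact: coefD. Qed.

End SkewPoly.
Arguments skew_mul : simpl never.

Section Frobenius.
Variables (F : finFieldType) (R : comNzRingType).

(* A ring morphism g : F[t] -> R makes R an A-algebra for A = F[t]; when R is
   a field it is an A-field, with theta = g 'X. *)
Definition frobq (g : {rmorphism {poly F} -> R}) (x : R) : R := x ^+ #|F|.

Variable g : {rmorphism {poly F} -> R}.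

Lemma pnat_pchar_card : [pchar R].-nat #|F|.
Proof.
have [p p_pr pF] := finPcharP F.
have pR : p \in [pchar R].
  by apply: (rmorph_pchar g); rewrite (rmorph_pchar (polyC : {rmorphism F -> _})).
have := abelem_pgroup (fin_ring_pchar_abelem pF); rewrite /pgroup cardsT.
by apply: sub_in_pnat => x _; rewrite inE => /eqP ->.
Qed.

Fact frobq_is_nmod_morphism : nmod_morphism (frobq g).
Proof.
split=> [|x y]; last exact: (exprDn_pchar _ _ pnat_pchar_card).
by rewrite /frobq expr0n eqn0Ngt (leq_trans _ (finNzRing_gt1 F)).
Qed.
Fact frobq_is_monoid_morphism : monoid_morphism (frobq g).
Proof. by split=> [|x y]; rewrite /frobq ?expr1n ?exprMn. Qed.

HB.instance Definition _ :=
  GRing.isNmodMorphism.Build R R (frobq g) frobq_is_nmod_morphism.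
HB.instance Definition _ :=
  GRing.isMonoidMorphism.Build R R (frobq g) frobq_is_monoid_morphism.

Local Notation tpoly := (skewpoly (frobq g)).

Definition tC (a : R) : tpoly := SkewPoly (frobq g) a%:P.
Definition tau : tpoly := SkewPoly (frobq g) 'X.
Definition tdiff (P : tpoly) : R := P`_0.
Definition teval (P : tpoly) (x : R) : R :=
  \sum_(i < size P) P`_i * iter i (frobq g) x.

Fact tC_is_nmod_morphism : nmod_morphism tC.
Proof.
by split=> [|x y]; apply: skewP => i; rewrite /= ?polyC0 ?polyCD.
Qed.
Fact tC_is_monoid_morphism : monoid_morphism tC.
Proof.
split=> [|x y]; apply: skewP => i; first by rewrite /= polyC1.
rewrite coef_skewM big_ord_recl subn0 !coefC /= big1 ?addr0 => [|j _].
  by case: i => //=; rewrite mulr0.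
by rewrite coefC mul0r.
Qed.
HB.instance Definition _ :=
  GRing.isNmodMorphism.Build R tpoly tC tC_is_nmod_morphism.
HB.instance Definition _ :=
  GRing.isMonoidMorphism.Build R tpoly tC tC_is_monoid_morphism.

End Frobenius.
Arguments tdiff {F R} g P.

(* R{tau} *)
Notation tpoly g := (skewpoly (frobq g)).

Section BaseChange.
Variables (F : finFieldType) (R S : comNzRingType).
Variables (g : {rmorphism {poly F} -> R}) (f : {rmorphism R -> S}).

Definition abase : {rmorphism {poly F} -> S} := f \o g.

Definition tmap (P : tpoly g) : tpoly abase :=
  SkewPoly (frobq abase) (map_poly f P).

Lemma coef_tmap P i : (tmap P)`_i = f P`_i.
Proof. exact: coef_map. Qed.

Fact tmap_is_nmod_morphism : nmod_morphism tmap.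
Proof.
by split=> [|x y]; apply: skewP => i; rewrite /= ?rmorph0 ?rmorphD.
Qed.
Fact tmap_is_monoid_morphism : monoid_morphism tmap.
Proof.
split=> [|x y]; apply: skewP => i; first by rewrite /= rmorph1.
rewrite coef_skewM coef_tmap coef_skewM rmorph_sum; apply: eq_bigr => j _.
rewrite rmorphM !coef_tmap; congr (_ * _).
by move: y`_(i - j) => z; elim: (j : nat) => //= k <-; rewrite /frobq rmorphXn.
Qed.
HB.instance Definition _ :=
  GRing.isNmodMorphism.Build (tpoly g) (tpoly abase) tmap tmap_is_nmod_morphism.
HB.instance Definition _ :=
  GRing.isMonoidMorphism.Build (tpoly g) (tpoly abase) tmap
    tmap_is_monoid_morphism.

End BaseChange.
Arguments tmap {F R S} g f P.

Section TModule.
Variables (F : finFieldType) (R : comNzRingType).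
Variable g : {rmorphism {poly F} -> R}.

Definition tangent d (T : 'M[tpoly g]_d) : Prop :=
  exists N : 'M[R]_d,
    (exists k, N ^+ k = 0) /\ map_mx (tdiff g) T = (g 'X)%:M + N.

(* A t-module of dimension d over R: an F-algebra morphism out of F[t]. *)
Record tmodule d := TModule {
  tm_hom :> {rmorphism {poly F} -> 'M[tpoly g]_d};
  tm_scalar : forall c : F, tm_hom c%:P = (tC g (g c%:P))%:M;
  tm_tangent : tangent (tm_hom 'X)
}.

Definition no_nilpotence d (Phi : tmodule d) : Prop :=
  map_mx (tdiff g) (Phi 'X) = (g 'X)%:M.

Section OfMatrix.
Variables (d : nat) (T : 'M[tpoly g]_d).

Definition tm_eval (a : {poly F}) : 'M[tpoly g]_d :=
  \sum_(i < size a) (tC g (g (a`_i)%:P))%:M * T ^+ i.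

Lemma tm_eval_widen n (a : {poly F}) : (size a <= n)%N ->
  tm_eval a = \sum_(i < n) (tC g (g (a`_i)%:P))%:M * T ^+ i.
Proof.
move=> le_a; pose G (i : nat) := (tC g (g (a`_i)%:P))%:M * T ^+ i.
rewrite /tm_eval (big_ord_widen _ G le_a) {}/G big_mkcond; apply: eq_bigr => i _; case: ltnP => // le_i.
by rewrite nth_default // !rmorph0 mul0r.
Qed.

Lemma tm_evalC c : tm_eval c%:P = (tC g (g c%:P))%:M.
Proof.
by rewrite (@tm_eval_widen 1) ?size_polyC_leq1 // big_ord1 coefC mulr1.
Qed.

Lemma tm_evalD a b : tm_eval (a + b) = tm_eval a + tm_eval b.
Proof.
pose n := maxn (size a) (size b).
rewrite (@tm_eval_widen n a) ?leq_maxl // (@tm_eval_widen n b) ?leq_maxr //.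
rewrite (@tm_eval_widen n) ?size_polyD // -big_split; apply: eq_bigr => i _ /=.
by rewrite coefD !rmorphD mulrDl.
Qed.

Lemma tm_evalMX a : tm_eval (a * 'X) = tm_eval a * T.
Proof.
rewrite (@tm_eval_widen (size a).+1); last first.
  by rewrite (leq_trans (size_polyMleq _ _)) // size_polyX addn2.
rewrite big_ord_recl coefMX /= !rmorph0 mul0r add0r mulr_suml.
by apply: eq_bigr => i _; rewrite coefMX /= -mulrA exprSr.
Qed.

Lemma tC_scalar_comm (c : F) (P : tpoly g) :
  tC g (g c%:P) * P = P * tC g (g c%:P).
Proof.
have fixc i : iter i (frobq g) (g c%:P) = g c%:P.
  by elim: i => //= i ->; rewrite /frobq -!rmorphXn /= expf_card.
apply: skewP => k; rewrite !coef_skewM big_ord_recl big_ord_recr /= subnn subn0.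
rewrite !coefC /= fixc mulrC big1 => [|i _]; last by rewrite coefC mul0r.
rewrite big1 ?addr0 ?add0r // => i _.
by rewrite coefC subn_eq0 leqNgt ltn_ord /= iter_morph0 mulr0.
Qed.

Lemma tm_evalM a b : tm_eval (a * b) = tm_eval a * tm_eval b.
Proof.
have commC c : GRing.comm (tC g (g c%:P))%:M T.
  apply/matrixP => i j; rewrite -mulmxE mul_scalar_mx !mxE (bigD1 j) //=.
  rewrite big1 ?addr0 => [|k /negPf k_j]; last by rewrite mxE k_j mulr0.
  by rewrite mxE eqxx mulr1n tC_scalar_comm.
have commCn c n := commrX n (commC c).
have evalZ c e : tm_eval (c%:P * e) = tm_eval c%:P * tm_eval e.
  rewrite tm_evalC (@tm_eval_widen (size e)) ?size_Cmul_leq //; last first.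
    by rewrite mul_polyC size_scale_leq.
  rewrite mulr_sumr; apply: eq_bigr => i _.
  by rewrite coefCM polyCM !rmorphM mulrA.
have commE c e : GRing.comm (tm_eval c%:P) (tm_eval e).
  rewrite tm_evalC; apply: commr_sum => i _; apply: commrM => //.
  by rewrite /GRing.comm -!rmorphM mulrC.
elim/poly_ind: b => [|b c IHb].
  by rewrite mulr0 /tm_eval size_poly0 !big_ord0 mulr0.
rewrite mulrDr mulrA !tm_evalD !tm_evalMX IHb mulrDr mulrA; congr (_ + _).
by rewrite mulrC evalZ commE.
Qed.

Fact tm_eval_is_nmod_morphism : nmod_morphism tm_eval.
Proof.
by split=> [|a b]; [rewrite /tm_eval size_poly0 big_ord0 | exact: tm_evalD].
Qed.
Fact tm_eval_is_monoid_morphism : monoid_morphism tm_eval.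
Proof.
by split=> [|a b]; [rewrite tm_evalC !rmorph1 | exact: tm_evalM].
Qed.
HB.instance Definition _ :=
  GRing.isNmodMorphism.Build {poly F} 'M[tpoly g]_d tm_eval
    tm_eval_is_nmod_morphism.
HB.instance Definition _ :=
  GRing.isMonoidMorphism.Build {poly F} 'M[tpoly g]_d tm_eval
    tm_eval_is_monoid_morphism.

Lemma tm_evalX : tm_eval 'X = T.
Proof.
by rewrite -['X]mul1r tm_evalMX -polyC1 tm_evalC !rmorph1 mul1r.
Qed.

Hypothesis T_tangent : tangent T.
Fact tm_eval_tangent : tangent (tm_eval 'X).
Proof. by rewrite tm_evalX. Qed.

Definition tmodule_of : tmodule d := TModule tm_evalC tm_eval_tangent.

End OfMatrix.

Lemma tangent_scalar d (P : tpoly g) : P`_0 = g 'X -> tangent (P%:M : 'M_d).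
Proof.
move=> P0; exists 0; split; first by exists 1%N; rewrite expr1.
apply/matrixP => i j; rewrite addr0 !mxE /tdiff -P0.
by case: eqP; rewrite ?mulr1n ?mulr0n ?coef0.
Qed.

Fact carlitz_tangent : tangent ((tC g (g 'X) + tau g)%:M : 'M_1).
Proof. by apply: tangent_scalar; rewrite /= coefD coefC coefX addr0. Qed.
Definition carlitz : tmodule 1 := tmodule_of carlitz_tangent.

Fact Ga_tangent s : tangent ((tC g (g 'X))%:M : 'M_s).
Proof. by apply: tangent_scalar; rewrite /= coefC. Qed.
Definition Ga s : tmodule s := tmodule_of (Ga_tangent s).

End TModule.

Section TModuleBaseChange.
Variables (F : finFieldType) (R S : comNzRingType).
Variables (g : {rmorphism {poly F} -> R}) (f : {rmorphism R -> S}).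
Variables (d : nat) (Phi : tmodule g d).

Definition tm_base_hom : {rmorphism {poly F} -> 'M[tpoly (abase g f)]_d} :=
  map_mx (tmap g f) \o Phi.

Fact tm_base_scalar c :
  tm_base_hom c%:P = (tC (abase g f) (abase g f c%:P))%:M.
Proof.
rewrite /= tm_scalar map_scalar_mx; congr (_%:M); apply: skewP => i.
by rewrite coef_tmap /= !coefC; case: eqP => // _; rewrite rmorph0.
Qed.

Fact tm_base_tangent : tangent (tm_base_hom 'X).
Proof.
have [N [[k Nk0] dPhi]] := tm_tangent Phi.
exists (map_mx f N); split; first by exists k; rewrite -rmorphXn Nk0 rmorph0.
rewrite /= -map_scalar_mx -map_mxD -dPhi.
by apply/matrixP => i j; rewrite !mxE /tdiff coef_tmap.
Qed.

Definition tm_base : tmodule (abase g f) d :=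
  TModule tm_base_scalar tm_base_tangent.

End TModuleBaseChange.

Section Morphisms.
Variables (F : finFieldType) (R : comNzRingType).
Variable g : {rmorphism {poly F} -> R}.

Definition tm_morphism d e (Phi : tmodule g d) (Psi : tmodule g e)
    (U : 'M[tpoly g]_(e, d)) : Prop :=
  forall a, U *m Phi a = Psi a *m U.

(* As tmodules of different dimensions are not isomorphic, the rectangular
   shape of V only spares casts. *)
Definition tm_iso d e (Phi : tmodule g d) (Psi : tmodule g e) : Prop :=
  exists (V : 'M[tpoly g]_(e, d)) (W : 'M[tpoly g]_(d, e)),
    [/\ W *m V = 1%:M, V *m W = 1%:M & tm_morphism Phi Psi V].

Definition mx_points d e (U : 'M[tpoly g]_(e, d)) (x : 'cV[R]_d) : 'cV[R]_e :=
  \col_i \sum_j teval (U i j) (x j 0).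

End Morphisms.

(* Exactness of 0 -> Phi -> E -> Psi -> 0 as a sequence of group schemes. Since
   H^1 of an affine scheme with values in a power of G_a vanishes, this is
   exactness on S-points for all commutative R-algebras S; points over an
   algebraic closure do not suffice, as tau is bijective on them. *)
Definition tm_exact (F : finFieldType) (R : comNzRingType)
    (g : {rmorphism {poly F} -> R}) d m e
    (Phi : tmodule g d) (E : tmodule g m) (Psi : tmodule g e) : Prop :=
  exists (u : 'M[tpoly g]_(m, d)) (v : 'M[tpoly g]_(e, m)),
    [/\ tm_morphism Phi E u, tm_morphism E Psi v &
      forall (S : comNzRingType) (f : {rmorphism R -> S}),
        let uS := mx_points (map_mx (tmap g f) u) in
        let vS := mx_points (map_mx (tmap g f) v) in
        [/\ injective uS,
            forall y, vS y = 0 <-> exists x, y = uS x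
          & forall z, exists y, vS y = z]].

(* A biderivation delta : F[t] -> Mat_(e, d) is given by its value at t. *)
Section Biderivations.
Variables (F : finFieldType) (R : comNzRingType).
Variable g : {rmorphism {poly F} -> R}.
Variables (d e : nat) (Phi : tmodule g d) (Psi : tmodule g e).

Definition Der_in (delta : 'M[tpoly g]_(e, d)) : Prop :=
  exists U : 'M[tpoly g]_(e, d), delta = U *m Phi 'X - Psi 'X *m U.

Definition Der0 (delta : 'M[tpoly g]_(e, d)) : Prop :=
  map_mx (tdiff g) delta = 0.

Definition Der_in0 (delta : 'M[tpoly g]_(e, d)) : Prop :=
  Der_in delta /\ Der0 delta.

End Biderivations.

Section Structures.
Variables (F : finFieldType) (R : comNzRingType).
Variable g : {rmorphism {poly F} -> R}.

(* The biderivation over an R-algebra S with coordinates c with respect to the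
   rows of b *)
Definition Der_rep d m (b : 'M[tpoly g]_(m, d)) (S : comNzRingType)
    (f : {rmorphism R -> S}) (c : 'cV[S]_m) : 'rV[tpoly (abase g f)]_d :=
  map_mx (tC (abase g f)) c^T *m map_mx (tmap g f) b.

(* E is the t-module structure on Ext^1_tau(Phi, C) in the coordinates of the
   reduced representatives \sum_i c_i * b_i: every class has exactly one such
   representative, and t * delta = C_t * delta becomes c |-> E_t c. Asking this
   over all commutative R-algebras makes E independent of b up to isomorphism
   (even over a finite field, where R-points do not determine E_t). *)
Definition Ext_structure d m (Phi : tmodule g d) (E : tmodule g m) : Prop :=
  exists b : 'M[tpoly g]_(m, d),
  forall (S : comNzRingType) (f : {rmorphism R -> S}),
    let C := carlitz (abase g f) in
    let inner := Der_in (tm_base f Phi) C in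
    (forall delta, exists! c, inner (delta - Der_rep b f c)) /\
    (forall c, inner (C 'X *m Der_rep b f c
                      - Der_rep b f (mx_points (tm_base f E 'X) c))).

(* Likewise, D is the t-module structure on the dual of Phi. *)
Definition dual_structure d m (Phi : tmodule g d) (D : tmodule g m) : Prop :=
  exists b : 'M[tpoly g]_(m, d), Der0 b /\
  forall (S : comNzRingType) (f : {rmorphism R -> S}),
    let C := carlitz (abase g f) in
    let inner := Der_in0 (tm_base f Phi) C in
    (forall delta, Der0 delta -> exists! c, inner (delta - Der_rep b f c)) /\
    (forall c, inner (C 'X *m Der_rep b f c
                      - Der_rep b f (mx_points (tm_base f D 'X) c))).

End Structures.

Section Triangular.
Variables (F : finFieldType) (R : comNzRingType).
Variable g : {rmorphism {poly F} -> R}.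

Definition drinfeld_of_rank (psi : tmodule g 1) (r : nat) : Prop :=
  (0 < r)%N /\
  exists a : nat -> R, a r != 0 /\
    psi 'X = (tC g (g 'X) + \sum_(1 <= i < r.+1) tC g (a i) * tau g ^+ i)%:M.

(* The ordinal l : 'I_n stands for the label l + 1. Labels run downwards from n,
   so the position k of the matrix has label rev_ord k. *)
Definition triangular_mx n (psi : 'I_n -> tmodule g 1)
    (delta : 'I_n -> 'I_n -> tpoly g) : 'M[tpoly g]_n :=
  \matrix_(k, l) let i := rev_ord k in let j := rev_ord l in
    if i == j then psi i 'X 0 0 else if (i < j)%N then delta i j else 0.

Definition triangular n (r : 'I_n -> nat) (psi : 'I_n -> tmodule g 1)
    (delta : 'I_n -> 'I_n -> tpoly g) (Ups : tmodule g n) : Prop :=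
  (forall l, drinfeld_of_rank (psi l) (r l)) /\
  Ups 'X = triangular_mx psi delta.

(* Degree bounds are stated with size = deg_tau + 1 (and size 0 = 0). *)
Definition reduced n (r : 'I_n -> nat) (delta : 'I_n -> 'I_n -> tpoly g) :=
  forall i j : 'I_n, (i < j)%N -> (size (delta i j) <= maxn (r i) (r j))%N.

Definition LD_bound n (r : 'I_n -> nat) (delta : 'I_n -> 'I_n -> tpoly g) :=
  forall j : 'I_n, (\max_(i < n | (i < j)%N) size (delta i j) <= r j)%N.

End Triangular.

Notation base_ext g L := (abase g (GRing.in_alg L)).

(* The finite extension L of K is a possible K(Ups): over L, Ups has a reduced
   form, which satisfies the condition for LD-biderivations. *)
Definition LD_over (F : finFieldType) (K : fieldType)
    (g : {rmorphism {poly F} -> K}) (n : nat) (r : 'I_n -> nat)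
    (Ups : tmodule g n) (L : fieldExtType K) : Prop :=
  exists (psi : 'I_n -> tmodule (base_ext g L) 1)
    (delta : 'I_n -> 'I_n -> tpoly (base_ext g L))
    (Upsred : tmodule (base_ext g L) n),
  [/\ triangular r psi delta Upsred, reduced r delta,
      tm_iso (tm_base (GRing.in_alg L) Ups) Upsred & LD_bound r delta].

(* Main.v *)
(* Over every K(Ups)-algebra S, let T be the value at t of the reduced form of
   Ups. Its j-th column has degree r_j with an invertible diagonal leading
   coefficient, so U |-> U T - C_t U raises degrees by exactly r_j (here r_j > 1
   is used) and division with remainder represents each class of Der_0(Ups, C)
   by a unique combination of the tau^i e_j with 0 < i < r_j. In these
   coordinates the dual D is explicit: companion blocks of theta + tau, plus a
   last column involving tau^2 and the coefficients of T. For a row W, the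
   equations of W D_t - C_t W in all but the last slot of a block can be solved
   recursively, since they read W_(j,i+1) tau = ..., and the remaining system of
   n equations is again of the leading-coefficient type, now with degree 2.
   Hence Der_0(D, C) / Der_in has the coordinates a_j^-1 tau e_(j, r_j - 1), and
   t acts on them exactly by T. Without nilpotence every inner biderivation has
   zero constant term, so constant terms give the quotient G_a^s of Ext^1(D, C)
   by the dual of D.

   That structures are unique up to isomorphism is a Yoneda argument. Unique
   representatives over S[x] are a priori polynomials in x, but the projection
   of S[x] onto the span of the x^(q^i) commutes with the Frobenius and so
   preserves inner biderivations; hence representatives are twisted
   polynomials. *)
From HB Require Import structures.
Require Import Defs.
From mathcomp Require Import all_boot all_order all_fingroup all_algebra all_solvable all_field.

Set Implicit Arguments.
Unset Strict Implicit.
Unset Printing Implicit Defensive.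

Import GRing.Theory.
Local Open Scope ring_scope.


(** * Twisted polynomials as additive maps *)

Section TwistedPolynomials.
Variables (F : finFieldType) (R : comNzRingType) (g : {rmorphism {poly F} -> R}).
Local Notation q := #|F|.

Lemma iter_frobq i x : iter i (frobq g) x = x ^+ (q ^ i).
Proof.
elim: i => [|i IHi] /=; first by rewrite expr1.
by rewrite IHi /frobq -exprM expnSr.
Qed.

Lemma frobqD (x y : R) : (x + y) ^+ q = x ^+ q + y ^+ q.
Proof. exact: (rmorphD (frobq g)). Qed.

Lemma frobq0 : (0 : R) ^+ q = 0.
Proof. exact: (rmorph0 (frobq g)). Qed.

Lemma frobq_sum (I : Type) (s : seq I) (P : pred I) (E : I -> R) :
  (\sum_(i <- s | P i) E i) ^+ q = \sum_(i <- s | P i) E i ^+ q.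
Proof. exact: (rmorph_sum (frobq g)). Qed.

Lemma coef_tCM a (P : tpoly g) i : (tC g a * P)`_i = a * P`_i.
Proof.
rewrite coef_skewM big_ord_recl subn0 coefC /= big1 ?addr0 // => j _.
by rewrite coefC mul0r.
Qed.

Lemma coef_MtC a (P : tpoly g) i : (P * tC g a)`_i = P`_i * a ^+ (q ^ i).
Proof.
rewrite coef_skewM big_ord_recr subnn coefC /= iter_frobq big1 ?add0r // => j _.
by rewrite coefC subn_eq0 leqNgt ltn_ord iter_morph0 mulr0.
Qed.

Lemma coef_tauM (P : tpoly g) i :
  (tau g * P)`_i = if i is k.+1 then P`_k ^+ q else 0.
Proof.
rewrite coef_skewM; case: i => [|i]; first by rewrite big_ord1 coefX mul0r.
rewrite big_ord_recl coefX mul0r add0r big_ord_recl coefX mul1r subSS subn0.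
by rewrite big1 ?addr0 // => j _; rewrite coefX mul0r.
Qed.

Lemma coef_Mtau (P : tpoly g) i :
  (P * tau g)`_i = if i is k.+1 then P`_k else 0.
Proof.
have q_gt0 j : (0 < q ^ j)%N by rewrite expn_gt0 (ltnW (finNzRing_gt1 F)).
rewrite coef_skewM; under eq_bigr do rewrite iter_frobq coefX.
case: i => [|i]; first by rewrite big_ord1 expr0n eqn0Ngt q_gt0 mulr0.
rewrite !big_ord_recr /= subnn subSnn expr1n mulr1 expr0n eqn0Ngt q_gt0 mulr0.
rewrite addr0 big1 ?add0r // => j _.
rewrite eqn_leq leqNgt ltn_subRL addn1 ltnS ltn_ord.
by rewrite expr0n eqn0Ngt q_gt0 mulr0.
Qed.

Lemma coef_skewN (P : tpoly g) i : (- P)`_i = - P`_i.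
Proof. exact: coefN. Qed.

Lemma coef_skewB (P Q : tpoly g) i : (P - Q)`_i = P`_i - Q`_i.
Proof. exact: coefB. Qed.

Lemma coef_skew0 i : (0 : tpoly g)`_i = 0.
Proof. exact: coef0. Qed.

Lemma coef_skew_sum (I : Type) (s : seq I) (P : pred I) (E : I -> tpoly g) k :
  (\sum_(i <- s | P i) E i)`_k = \sum_(i <- s | P i) (E i)`_k.
Proof.
by apply: (big_morph (fun p : tpoly g => p`_k)) => [x y|];
  [exact: coef_skewD | exact: coef0].
Qed.

Lemma coef_tau_exp k i : (tau g ^+ k)`_i = (i == k)%:R.
Proof.
elim: k i => [|k IHk] i; first by rewrite expr0 coef1.
by rewrite exprSr coef_Mtau; case: i => // i; rewrite IHk.
Qed.

Lemma tevalE n (P : tpoly g) x : (size P <= n)%N ->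
  teval P x = \sum_(i < n) P`_i * x ^+ (q ^ i).
Proof.
move=> le_P; pose G i := P`_i * iter i (frobq g) x.
rewrite /teval (big_ord_widen _ G le_P) {}/G big_mkcond; apply: eq_bigr => i _.
by case: ltnP => [_|le_i]; rewrite ?iter_frobq // nth_default ?mul0r.
Qed.

Lemma tevalD (P Q : tpoly g) x : teval (P + Q) x = teval P x + teval Q x.
Proof.
pose n := maxn (size P) (size Q).
rewrite (@tevalE n P) ?leq_maxl // (@tevalE n Q) ?leq_maxr //.
rewrite (@tevalE n) ?size_polyD // -big_split; apply: eq_bigr => i _.
by rewrite coef_skewD mulrDl.
Qed.

Lemma teval0 x : teval (0 : tpoly g) x = 0.
Proof. by rewrite /teval size_poly0 big_ord0. Qed.

Lemma teval_sum (I : Type) (s : seq I) (P : pred I) (E : I -> tpoly g) x :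
  teval (\sum_(i <- s | P i) E i) x = \sum_(i <- s | P i) teval (E i) x.
Proof.
apply: (big_morph (fun p : tpoly g => teval p x)) => [y z|]; first exact: tevalD.
exact: teval0.
Qed.

Lemma teval_addr (P : tpoly g) x y : teval P (x + y) = teval P x + teval P y.
Proof.
rewrite /teval -big_split; apply: eq_bigr => i _ /=.
by rewrite iter_morphD mulrDr.
Qed.

Lemma teval_0r (P : tpoly g) : teval P 0 = 0.
Proof. by rewrite /teval big1 // => i _; rewrite iter_morph0 mulr0. Qed.

Lemma teval_sumr (I : Type) (s : seq I) (B : pred I) (E : I -> R) (P : tpoly g) :
  teval P (\sum_(i <- s | B i) E i) = \sum_(i <- s | B i) teval P (E i).
Proof. exact: (big_morph _ (teval_addr P) (teval_0r P)). Qed.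

Lemma teval_tC a x : teval (tC g a) x = a * x.
Proof.
by rewrite (@tevalE 1) ?size_polyC_leq1 // big_ord1 coefC expr1.
Qed.

Lemma teval_tauM (P : tpoly g) x : teval (tau g * P) x = teval P x ^+ q.
Proof.
rewrite (@tevalE (size P).+1); last first.
  by apply/leq_sizeP => -[|i] // le_i; rewrite coef_tauM nth_default // frobq0.
rewrite big_ord_recl coef_tauM mul0r add0r (tevalE _ (leqnn _)) frobq_sum.
by apply: eq_bigr => i _; rewrite coef_tauM exprMn -exprM expnSr.
Qed.

Lemma teval_tCM a (P : tpoly g) x : teval (tC g a * P) x = a * teval P x.
Proof.
rewrite (@tevalE (size P)); last first.
  by apply/leq_sizeP => i le_i; rewrite coef_tCM nth_default // mulr0.
rewrite (tevalE _ (leqnn _)) mulr_sumr.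
by apply: eq_bigr => i _; rewrite coef_tCM mulrA.
Qed.

Lemma skew_expand (P : tpoly g) : P = \sum_(i < size P) tC g P`_i * tau g ^+ i.
Proof.
apply: skewP => k; rewrite coef_skew_sum.
under eq_bigr do rewrite coef_tCM coef_tau_exp.
have [lt_k|le_k] := ltnP k (size P).
  rewrite (bigD1 (Ordinal lt_k)) //= eqxx mulr1 big1 ?addr0 // => i.
  by rewrite -val_eqE /= eq_sym => /negPf ->; rewrite mulr0.
rewrite nth_default // big1 // => i _.
by rewrite gtn_eqF ?mulr0 // (leq_trans (ltn_ord i)).
Qed.

(** Twisted multiplication is composition of additive maps: expanding [P] reduces the claim to left
    factors that are constants or powers of [tau]. *)
Lemma tevalM (P Q : tpoly g) x : teval (P * Q) x = teval P (teval Q x).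
Proof.
have tau_n n (U : tpoly g) : teval (tau g ^+ n * U) x = teval U x ^+ (q ^ n).
  elim: n => [|n IHn]; first by rewrite mul1r expr1.
  by rewrite exprS -mulrA teval_tauM IHn -exprM -expnSr.
rewrite {1}[P]skew_expand mulr_suml teval_sum (tevalE _ (leqnn (size P))).
by apply: eq_bigr => i _; rewrite -mulrA teval_tCM tau_n.
Qed.

Lemma mx_pointsM k m p (U : 'M[tpoly g]_(m, k)) (V : 'M[tpoly g]_(k, p)) x :
  mx_points (U *m V) x = mx_points U (mx_points V x).
Proof.
apply/matrixP => i j; rewrite !mxE.
under eq_bigr do rewrite mxE teval_sum.
rewrite exchange_big; apply: eq_bigr => l _.
by rewrite mxE teval_sumr; apply: eq_bigr => h _; rewrite tevalM.
Qed.

Lemma mx_points_scalar m (P : tpoly g) (x : 'cV_m) :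
  mx_points (P%:M : 'M_m) x = \col_i teval P (x i 0).
Proof.
apply/matrixP => i j; rewrite !mxE (bigD1 i) //= big1 ?addr0 => [|k].
  by rewrite mxE eqxx mulr1n.
by rewrite eq_sym => /negPf ik; rewrite mxE ik mulr0n teval0.
Qed.

Lemma mx_points1 m (x : 'cV_m) : mx_points (1%:M : 'M[tpoly g]_m) x = x.
Proof.
rewrite mx_points_scalar; apply/matrixP => i j; rewrite mxE (ord1 j).
by rewrite -(rmorph1 (tC g)) teval_tC mul1r.
Qed.

Lemma mx_points0 m k (x : 'cV_k) : mx_points (0 : 'M[tpoly g]_(m, k)) x = 0.
Proof.
by apply/matrixP => i j; rewrite !mxE big1 // => l _; rewrite mxE teval0.
Qed.

Lemma mx_points_col m1 m2 k (U : 'M[tpoly g]_(m1, k)) (V : 'M_(m2, k)) x :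
  mx_points (col_mx U V) x = col_mx (mx_points U x) (mx_points V x).
Proof.
apply/matrixP => i j; rewrite !mxE; case: splitP => h ih; rewrite mxE;
  apply: eq_bigr => l _; congr teval.
  by rewrite (_ : i = lshift _ h) ?col_mxEu //; apply: val_inj.
by rewrite (_ : i = rshift _ h) ?col_mxEd //; apply: val_inj.
Qed.

Lemma mx_points_row m k1 k2 (U : 'M[tpoly g]_(m, k1)) (V : 'M_(m, k2)) x y :
  mx_points (row_mx U V) (col_mx x y) = mx_points U x + mx_points V y.
Proof.
apply/matrixP => i j; rewrite !mxE big_split_ord /=.
by congr (_ + _); apply: eq_bigr => l _;
  rewrite ?row_mxEl ?row_mxEr ?col_mxEu ?col_mxEd.
Qed.

End TwistedPolynomials.


(** * Change of scalars for twisted polynomials *)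

Section ScalarExtension.
Variables (F : finFieldType) (R S : comNzRingType).
Variables (g : {rmorphism {poly F} -> R}) (k : {rmorphism {poly F} -> S}).
Variable h : {rmorphism R -> S}.

(* Unlike tmap, the target structure k is not tied to the composite h \o g, so
   that two factorisations of a base change land in the same type. *)
Definition smap (P : tpoly g) : tpoly k := SkewPoly (frobq k) (map_poly h P).

Lemma coef_smap P i : (smap P)`_i = h P`_i.
Proof. exact: coef_map. Qed.

Fact smap_is_nmod_morphism : nmod_morphism smap.
Proof. by split=> [|x y]; apply: skewP => i; rewrite /= ?rmorph0 ?rmorphD. Qed.
Fact smap_is_monoid_morphism : monoid_morphism smap.
Proof.
split=> [|x y]; apply: skewP => i; first by rewrite /= rmorph1.
rewrite coef_skewM coef_smap coef_skewM rmorph_sum; apply: eq_bigr => j _.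
by rewrite rmorphM !coef_smap !iter_frobq rmorphXn.
Qed.
HB.instance Definition _ :=
  GRing.isNmodMorphism.Build (tpoly g) (tpoly k) smap smap_is_nmod_morphism.
HB.instance Definition _ :=
  GRing.isMonoidMorphism.Build (tpoly g) (tpoly k) smap smap_is_monoid_morphism.

Lemma smap_tC a : smap (tC g a) = tC k (h a).
Proof. by apply: skewP => i; rewrite coef_smap !coefC (fun_if h) rmorph0. Qed.

Lemma smap_tau : smap (tau g) = tau k.
Proof. by apply: skewP => i; rewrite coef_smap !coefX rmorph_nat. Qed.

Lemma smap_teval P x : h (teval P x) = teval (smap P) (h x).
Proof.
rewrite (tevalE _ (leqnn _)) (@tevalE _ _ _ (size P)) ?size_poly // rmorph_sum.
by apply: eq_bigr => i _; rewrite rmorphM rmorphXn coef_smap.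
Qed.

Lemma smap_Der0 d e (delta : 'M[tpoly g]_(e, d)) :
  Der0 delta -> Der0 (map_mx smap delta).
Proof.
move=> /matrixP d0; apply/matrixP => i j; have := d0 i j; rewrite !mxE /tdiff.
by rewrite coef_smap => ->; rewrite rmorph0.
Qed.

End ScalarExtension.
Arguments smap {F R S} g k h P.

(** * Constant terms, representatives and inner biderivations *)

Section ConstantTerm.
Variables (F : finFieldType) (R : comNzRingType) (g : {rmorphism {poly F} -> R}).

Lemma tdiff_is_nmod_morphism : nmod_morphism (tdiff g).
Proof. by split=> [|P Q]; rewrite /tdiff ?coef_skew0 ?coef_skewD. Qed.
Lemma tdiff_is_monoid_morphism : monoid_morphism (tdiff g).
Proof.
by split=> [|P Q]; rewrite /tdiff ?coef1 // coef_skewM big_ord1.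
Qed.
HB.instance Definition _ :=
  GRing.isNmodMorphism.Build (tpoly g) R (tdiff g) tdiff_is_nmod_morphism.
HB.instance Definition _ :=
  GRing.isMonoidMorphism.Build (tpoly g) R (tdiff g) tdiff_is_monoid_morphism.

Lemma Der0_mulr e d d' (x : 'M[tpoly g]_(e, d)) (V : 'M_(d, d')) :
  Der0 x -> Der0 (x *m V).
Proof. by rewrite /Der0 map_mxM => ->; rewrite mul0mx. Qed.

Lemma Der0_mull e d d' (V : 'M[tpoly g]_(e, d)) (x : 'M_(d, d')) :
  Der0 x -> Der0 (V *m x).
Proof. by rewrite /Der0 map_mxM => ->; rewrite mulmx0. Qed.

Lemma Der0B e d (x y : 'M[tpoly g]_(e, d)) : Der0 x -> Der0 y -> Der0 (x - y).
Proof. by rewrite /Der0 map_mxB => -> ->; rewrite subr0. Qed.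

Lemma carlitzX : carlitz g 'X = (tC g (g 'X) + tau g)%:M.
Proof. exact: tm_evalX. Qed.

Fact rep_key : unit. Proof. by []. Qed.

(* Locked: unifying two different representatives must not unfold products. *)
Definition rep :
    forall d m, 'M[tpoly g]_(m, d) -> 'cV[R]_m -> 'rV[tpoly g]_d :=
  locked_with rep_key (fun d m b c => map_mx (tC g) c^T *m b).
Arguments rep {d m}.

Lemma repE d m (b : 'M[tpoly g]_(m, d)) c : rep b c = map_mx (tC g) c^T *m b.
Proof. by rewrite /rep locked_withE. Qed.

Lemma repB d m (b : 'M[tpoly g]_(m, d)) c c' :
  rep b (c - c') = rep b c - rep b c'.
Proof. by rewrite !repE linearB /= map_mxB mulmxBl. Qed.

Lemma repD d m (b : 'M[tpoly g]_(m, d)) c c' :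
  rep b (c + c') = rep b c + rep b c'.
Proof. by rewrite !repE linearD /= map_mxD mulmxDl. Qed.

Lemma rep0 d m (b : 'M[tpoly g]_(m, d)) : rep b 0 = 0.
Proof. by rewrite !repE linear0 map_mx0 mul0mx. Qed.

Lemma rep_sum d m (b : 'M[tpoly g]_(m, d)) (I : Type) (s : seq I)
    (P : pred I) (E : I -> 'cV_m) :
  rep b (\sum_(i <- s | P i) E i) = \sum_(i <- s | P i) rep b (E i).
Proof. exact: (big_morph _ (repD b) (rep0 b)). Qed.

Lemma coef_rep d m (b : 'M[tpoly g]_(m, d)) c i j k :
  (rep b c i j)`_k = \sum_l c l 0 * (b l j)`_k.
Proof.
rewrite repE mxE coef_skew_sum; apply: eq_bigr => l _.
by rewrite !mxE (ord1 i) coef_tCM.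
Qed.

(** One predicate serves both quotients: Der_in for Ext^1 ([z = false]) and Der_in,0 for the dual
    ([z = true]). *)
Definition inner (z : bool) d (Phi : tmodule g d) (delta : 'rV[tpoly g]_d) :=
  Der_in Phi (carlitz g) delta /\ (z -> Der0 delta).

Section Inner.
Variables (z : bool) (d : nat) (Phi : tmodule g d).

Lemma inner0 : inner z Phi 0.
Proof.
split=> [|_]; last by rewrite /Der0 map_mx0.
by exists 0; rewrite mul0mx mulmx0 subr0.
Qed.

Lemma innerB x y : inner z Phi x -> inner z Phi y -> inner z Phi (x - y).
Proof.
move=> [[U ->] x0] [[V ->] y0]; split=> [|zT].
  by exists (U - V); rewrite mulmxBl mulmxBr; rewrite !opprD !opprK addrACA.
exact: Der0B (x0 zT) (y0 zT).
Qed.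

Lemma innerN x : inner z Phi x -> inner z Phi (- x).
Proof. by move=> ix; rewrite -sub0r; apply: innerB ix; apply: inner0. Qed.

Lemma innerD x y : inner z Phi x -> inner z Phi y -> inner z Phi (x + y).
Proof. by move=> ix iy; rewrite -[y]opprK; apply: innerB ix (innerN iy). Qed.

Lemma inner_sum (I : Type) (s : seq I) (P : pred I) E :
    (forall i, inner z Phi (E i)) -> inner z Phi (\sum_(i <- s | P i) E i).
Proof. by move=> iE; elim/big_ind: _ => //; [apply: inner0 | apply: innerD]. Qed.

Lemma inner_sym x y : inner z Phi (x - y) -> inner z Phi (y - x).
Proof. by move=> ixy; rewrite -opprB; apply: innerN. Qed.

Lemma inner_trans x y w :
  inner z Phi (x - y) -> inner z Phi (y - w) -> inner z Phi (x - w).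
Proof. by move=> ixy iyw; have := innerD ixy iyw; rewrite addrA subrK. Qed.

(** If [U] witnesses that [x - y] is inner, then C_t U witnesses it for the product, because C_t
    commutes with itself. *)
Lemma inner_carlitz x y :
  inner z Phi (x - y) -> inner z Phi (carlitz g 'X *m x - carlitz g 'X *m y).
Proof.
rewrite -mulmxBr; move: (x - y) => {x y} _ [[U ->] x0].
split=> [|zT]; last by apply: Der0_mull; apply: x0.
by exists (carlitz g 'X *m U); rewrite mulmxBr !mulmxA.
Qed.

End Inner.

End ConstantTerm.
Arguments rep {F R g d m}.

Lemma smap_rep (F : finFieldType) (R S : comNzRingType)
    (g : {rmorphism {poly F} -> R}) (k : {rmorphism {poly F} -> S})
    (h : {rmorphism R -> S}) d m (b : 'M[tpoly g]_(m, d)) c :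
  map_mx (smap g k h) (rep b c) = rep (map_mx (smap g k h) b) (map_mx h c).
Proof.
rewrite !repE map_mxM; congr (_ *m _).
by apply/matrixP => i j; rewrite !mxE /= smap_tC.
Qed.

Lemma smap_inner (F : finFieldType) (R S : comNzRingType)
    (g : {rmorphism {poly F} -> R}) (k : {rmorphism {poly F} -> S})
    (h : {rmorphism R -> S}) z d (Phi : tmodule g d) (Psi : tmodule k d) x :
    h (g 'X) = k 'X -> map_mx (smap g k h) (Phi 'X) = Psi 'X ->
  inner z Phi x -> inner z Psi (map_mx (smap g k h) x).
Proof.
move=> hX PhiX [[U ->] x0]; split=> [|zT]; last by apply/smap_Der0/x0.
exists (map_mx (smap g k h) U); rewrite map_mxB !map_mxM /= PhiX.
congr (_ - _ *m _).
by rewrite !carlitzX map_scalar_mx rmorphD /= smap_tC smap_tau hX.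
Qed.

Definition polyC_rmorphism (R : comNzRingType) : {rmorphism R -> {poly R}} :=
  polyC.

(** * Projection onto additive polynomials *)

Section QPowers.
Variables (F : finFieldType) (R : comNzRingType) (g : {rmorphism {poly F} -> R}).
Local Notation q := #|F|.
Local Notation gX := (abase g (polyC_rmorphism R)).

(** A left inverse of [topoly]. The bound [size p] cuts off nothing, since i < q^i. *)
Definition lin (p : {poly R}) : tpoly g :=
  SkewPoly (frobq g) (\poly_(i < size p) p`_(q ^ i)).

Lemma coef_lin p i : (lin p)`_i = p`_(q ^ i).
Proof.
rewrite coef_poly; case: ltnP => // le_i; rewrite nth_default //.
by rewrite (leq_trans le_i) // ltnW // ltn_expl // finNzRing_gt1.
Qed.

Lemma coef_tmapX (P : tpoly g) i :
  (tmap g (polyC_rmorphism R) P)`_i = (P`_i)%:P.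
Proof. exact: coef_tmap. Qed.

(** The additive polynomial in x with coefficient P_i at x^(q^i). *)
Definition topoly (P : tpoly g) : {poly R} :=
  teval (tmap g (polyC_rmorphism R) P) 'X.

(* The projection onto the span of the monomials 'X^(q ^ i). *)
Definition qproj p := topoly (lin p).

Lemma qprojD : {morph qproj : p r / p + r}.
Proof.
move=> p r; rewrite /qproj /topoly -tevalD -rmorphD; congr (teval (tmap _ _ _) _).
by apply: skewP => i; rewrite coef_skewD !coef_lin coefD.
Qed.

Lemma qproj0 : qproj 0 = 0.
Proof.
rewrite /qproj (_ : lin 0 = 0) /topoly ?rmorph0 ?teval0 //.
by apply: skewP => i; rewrite coef_lin !coef0.
Qed.

Lemma qproj_sum (I : Type) (s : seq I) (P : pred I) E :
  qproj (\sum_(i <- s | P i) E i) = \sum_(i <- s | P i) qproj (E i).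
Proof. exact: (big_morph _ qprojD qproj0). Qed.

Lemma qprojCM a p : qproj (a%:P * p) = a%:P * qproj p.
Proof.
rewrite /qproj (_ : lin _ = tC g a * lin p) /topoly; last first.
  by apply: skewP => i; rewrite coef_tCM !coef_lin coefCM.
rewrite rmorphM /= (_ : tmap g _ (tC g a) = tC gX a%:P) ?teval_tCM //.
by apply: skewP => i; rewrite coef_tmapX !coefC; case: eqP => _ //; rewrite rmorph0.
Qed.

Lemma frobq_polyE (p : {poly R}) : p ^+ q = map_poly (frobq g) p \Po 'X^q.
Proof.
elim/poly_ind: p => [|p c IHp]; first by rewrite rmorph0 comp_poly0 (frobq0 gX).
rewrite (frobqD gX) exprMn IHp rmorphD rmorphM /= map_polyX map_polyC /=.
by rewrite comp_polyD comp_polyM comp_polyX comp_polyC polyC_exp.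
Qed.

(** The monomials of p^q have exponents divisible by q, so the coefficient at q^0 vanishes and the
    one at q^(i+1) is the q-th power of that of p at q^i. Hence [lin (p ^+ q)] is
    [tau g * lin p]. *)
Lemma qproj_frobq p : qproj (p ^+ q) = qproj p ^+ q.
Proof.
have q_gt1 := finNzRing_gt1 F; have q_gt0 := ltnW q_gt1.
rewrite /qproj (_ : lin _ = tau g * lin p) /topoly; last first.
  apply: skewP => i; rewrite coef_lin frobq_polyE coef_comp_poly_Xn // coef_tauM.
  case: i => [|i]; first by rewrite expn0 dvdn1 gtn_eqF.
  by rewrite coef_lin expnS dvdn_mulr // mulKn // coef_map.
rewrite rmorphM /= (_ : tmap g (polyC_rmorphism R) (tau g) = tau gX) ?teval_tauM //.
by apply: skewP => i; rewrite coef_tmapX !coefX rmorph_nat.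
Qed.

Lemma qprojX : qproj 'X = 'X.
Proof.
rewrite /qproj (_ : lin _ = 1) /topoly.
  by rewrite !rmorph1 -(rmorph1 (tC gX)) teval_tC mul1r.
have q_gt1 := finNzRing_gt1 F; apply: skewP => i.
by rewrite coef_lin coefX coef1 -[X in _ == X](expn0 q) eqn_exp2l.
Qed.

Definition qprojt (P : tpoly gX) : tpoly gX :=
  SkewPoly (frobq gX) (map_poly qproj P).

Lemma coef_qprojt P i : (qprojt P)`_i = qproj P`_i.
Proof. by rewrite coef_map_id0 // qproj0. Qed.

Lemma qprojtB P Q : qprojt (P - Q) = qprojt P - qprojt Q.
Proof.
apply: skewP => i; rewrite coef_skewB !coef_qprojt coef_skewB qprojD.
by congr (_ + _); rewrite -mulN1r -polyC1 -polyCN qprojCM polyCN polyC1 mulN1r.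
Qed.

Lemma qprojt_sum (I : Type) (s : seq I) (P : pred I) E :
  qprojt (\sum_(i <- s | P i) E i) = \sum_(i <- s | P i) qprojt (E i).
Proof.
apply: skewP => i; rewrite coef_skew_sum coef_qprojt coef_skew_sum qproj_sum.
by apply: eq_bigr => j _; rewrite coef_qprojt.
Qed.

(** In each coefficient of the product the factors from [Q] are constant in x, and [qproj] is
    [R]-linear. *)
Lemma qprojtM P Q :
  qprojt (P * tmap g (polyC_rmorphism R) Q) =
  qprojt P * tmap g (polyC_rmorphism R) Q.
Proof.
apply: skewP => i; rewrite coef_qprojt !coef_skewM qproj_sum.
apply: eq_bigr => j _; rewrite coef_qprojt iter_frobq coef_tmapX -polyC_exp.
by rewrite mulrC qprojCM mulrC.
Qed.


End QPowers.


(** * Ext and dual structures, and their uniqueness *)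

Section Representations.
Variables (F : finFieldType) (R : comNzRingType) (g : {rmorphism {poly F} -> R}).
Local Notation pC := (polyC_rmorphism R).
Local Notation gX := (abase g (polyC_rmorphism R)).

Lemma Der_repE d m (b : 'M[tpoly g]_(m, d)) (S : comNzRingType)
    (f : {rmorphism R -> S}) c :
  Der_rep b f c = rep (map_mx (tmap g f) b) c.
Proof. by rewrite repE. Qed.

Lemma qproj_rep d m (b : 'M[tpoly g]_(m, d)) c :
  map_mx (@qprojt _ _ g) (Der_rep b pC c) =
  Der_rep b pC (map_mx (qproj g) c).
Proof.
rewrite !Der_repE; apply/matrixP => i j; rewrite mxE; apply: skewP => k.
rewrite coef_qprojt [X in qproj _ X]coef_rep qproj_sum [RHS]coef_rep.
apply: eq_bigr => l _.
by rewrite !mxE coef_tmapX mulrC qprojCM mulrC.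
Qed.

Lemma qproj_mxB m d (x y : 'M[tpoly gX]_(m, d)) :
  map_mx (@qprojt _ _ g) (x - y) =
  map_mx (@qprojt _ _ g) x - map_mx (@qprojt _ _ g) y.
Proof. by apply/matrixP => i j; rewrite !mxE qprojtB. Qed.

(** The projected [U] is a witness: right multiplication by Phi_t commutes with the projection by
    [R]-linearity, left multiplication by C_t because the projection also commutes with the
    Frobenius. *)
Lemma qproj_inner z d (Phi : tmodule g d) x :
  inner z (tm_base pC Phi) x ->
  inner z (tm_base pC Phi) (map_mx (@qprojt _ _ g) x).
Proof.
move=> [[U ->] x0]; split=> [|/x0 /matrixP d0]; last first.
  apply/matrixP => i j; have := d0 i j; rewrite !mxE /tdiff coef_qprojt => ->.
  exact: qproj0.
exists (map_mx (@qprojt _ _ g) U).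
rewrite carlitzX !mul_scalar_mx; apply/matrixP => i j.
rewrite !mxE qprojtB qprojt_sum; congr (_ - _).
  by apply: eq_bigr => l _; rewrite !mxE qprojtM.
apply: skewP => k; rewrite coef_qprojt !mulrDl !coef_skewD !coef_tCM !coef_tauM.
rewrite qprojD qprojCM coef_qprojt; congr (_ + _); case: k => [|k].
  exact: qproj0.
by rewrite coef_qprojt (qproj_frobq g).
Qed.

(* The flag z selects biderivations without constant term, as in the dual;
   without it one gets Ext^1. *)
Definition represents (z : bool) d m (Phi : tmodule g d) (b : 'M[tpoly g]_(m, d)) :=
  (z -> Der0 b) /\
  forall (S : comNzRingType) (f : {rmorphism R -> S}) delta,
    (z -> Der0 delta) ->
    exists! c, inner z (tm_base f Phi) (delta - Der_rep b f c).

Definition z_structure (z : bool) d m (Phi : tmodule g d) (b : 'M[tpoly g]_(m, d))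
    (E : 'M[tpoly g]_m) :=
  represents z Phi b /\
  forall (S : comNzRingType) (f : {rmorphism R -> S}) c,
    inner z (tm_base f Phi)
      (carlitz (abase g f) 'X *m Der_rep b f c
       - Der_rep b f (mx_points (map_mx (tmap g f) E) c)).

Lemma Der_rep0 (z : bool) d m (b : 'M[tpoly g]_(m, d)) (S : comNzRingType)
    (f : {rmorphism R -> S}) c : (z -> Der0 b) -> z -> Der0 (Der_rep b f c).
Proof. by move=> b0 /b0 d0; apply/Der0_mull/(smap_Der0 (abase g f) f). Qed.

Lemma represents_inj (z : bool) d m (Phi : tmodule g d) (b : 'M[tpoly g]_(m, d))
    (S : comNzRingType) (f : {rmorphism R -> S}) c c' :
  represents z Phi b ->
  inner z (tm_base f Phi) (Der_rep b f c - Der_rep b f c') -> c = c'.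
Proof.
move=> [b0 /(_ S f _ (Der_rep0 f c b0))[e [_ e_uniq]]] icc'.
rewrite -(e_uniq _ icc'); apply/esym/e_uniq.
by rewrite subrr; apply: inner0.
Qed.

Lemma smap_tmap (S S' : comNzRingType) (f : {rmorphism R -> S})
    (h : {rmorphism S -> S'}) (f' : {rmorphism R -> S'}) (P : tpoly g) :
  h \o f =1 f' -> smap (abase g f) (abase g f') h (tmap g f P) = tmap g f' P.
Proof. by move=> hf; apply: skewP => i; rewrite coef_smap !coef_tmap -hf. Qed.

(* The representative over R[x] of the class of x times a biderivation is a
   vector of twisted polynomials in x: projecting an inner biderivation onto
   the span of the x^(q^i) keeps it inner, so the projected coordinates
   represent the same class. *)
Lemma represents_linear (z : bool) d m m' (Phi : tmodule g d) (b : 'M[tpoly g]_(m, d))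
    (b' : 'M[tpoly g]_(m', d)) :
    represents z Phi b -> (z -> Der0 b') ->
  exists V : 'M[tpoly g]_(m, m'),
    forall (S : comNzRingType) (f : {rmorphism R -> S}) c,
    inner z (tm_base f Phi)
      (Der_rep b' f c - Der_rep b f (mx_points (map_mx (tmap g f) V) c)).
Proof.
(* The variable x in slot [i] is the universal point of the [i]-th coordinate axis. *)
move=> rep_b b'0; pose e i : 'cV[{poly R}]_m' := \col_k ('X *+ (k == i)).
have /fin_all_exists[c cP] i : exists c, map_mx (qproj g) c = c /\
    inner z (tm_base pC Phi) (Der_rep b' pC (e i) - Der_rep b pC c).
  have [c [ic uniq_c]] := rep_b.2 _ pC _ (Der_rep0 pC (e i) b'0).
  exists c; split=> //; apply/esym/uniq_c; have := qproj_inner ic.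
  rewrite qproj_mxB !qproj_rep.
  suff -> : map_mx (qproj g) (e i) = e i by exact.
  apply/matrixP => k l.
  by rewrite !mxE; case: (k == i); rewrite ?mulr1n ?mulr0n ?qprojX ?qproj0.
exists (\matrix_(k, i) lin g (c i k 0)) => S f x.
have commx i : commr_rmorph f (x i 0) by move=> a; apply: mulrC.
(* Specialising x to the [i]-th coordinate of the given vector and summing over [i] recovers an
   arbitrary point over [S]. *)
pose h i : {rmorphism {poly R} -> S} := horner_morph (commx i).
have hC i : h i \o pC =1 f by move=> a; apply: horner_morphC.
have hX i : h i 'X = x i 0 by apply: horner_morphX.
have hrep i n (B : 'M[tpoly g]_(n, d)) v :
    map_mx (smap gX (abase g f) (h i)) (Der_rep B pC v) =
    Der_rep B f (map_mx (h i) v).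
  rewrite !Der_repE smap_rep; congr (rep _ _); apply/matrixP => k l.
  by rewrite !mxE; apply: smap_tmap.
rewrite {1}(_ : x = \sum_i map_mx (h i) (e i)); last first.
  apply/matrixP => k l; rewrite (ord1 l) summxE (bigD1 k) //= !mxE eqxx hX.
  rewrite big1 ?addr0 // => i ik.
  by rewrite !mxE eq_sym (negPf ik) mulr0n rmorph0.
rewrite (_ : mx_points _ x = \sum_i map_mx (h i) (c i)); last first.
  apply/matrixP => k l; rewrite (ord1 l) mxE summxE; apply: eq_bigr => i _.
  rewrite !mxE -{2}(cP i).1 mxE /qproj /topoly.
  rewrite (smap_teval (abase g f)) hX; congr teval.
  by apply/esym; apply: smap_tmap.
rewrite !Der_repE !rep_sum -sumrB; apply: inner_sum => i.
rewrite -!Der_repE -!hrep -map_mxB; apply: smap_inner (cP i).2.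
  exact: horner_morphC.
by apply/matrixP => k l; rewrite !mxE; apply: smap_tmap.
Qed.

(** Putting the variable x of [{poly R}] in slot [i] yields the additive polynomials of the [i]-th
    column, and these determine all coefficients of the twisted polynomials. *)
Lemma mx_points_inj m m' (U V : 'M[tpoly g]_(m, m')) :
    (forall (S : comNzRingType) (f : {rmorphism R -> S}) x,
      mx_points (map_mx (tmap g f) U) x = mx_points (map_mx (tmap g f) V) x) ->
  U = V.
Proof.
move=> UV; apply/matrixP => k i.
have /matrixP/(_ k 0) := UV _ pC (\col_l ('X *+ (l == i))).
have E (W : 'M[tpoly g]_(m, m')) :
    mx_points (map_mx (tmap g pC) W) (\col_l ('X *+ (l == i))) k 0
    = topoly (W k i).
  rewrite mxE (bigD1 i) //= big1 => [|l /negPf li].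
    by rewrite !mxE eqxx mulr1n addr0.
  by rewrite !mxE li mulr0n teval_0r.
rewrite !E => eqUV; apply: skewP => n.
have coefT (P : tpoly g) : (topoly P)`_(#|F| ^ n) = P`_n.
  rewrite /topoly (@tevalE _ _ _ (maxn (size P) n.+1)); last first.
    by rewrite (leq_trans (size_poly _ _)) // leq_maxl.
  rewrite coef_sum (bigD1 (Ordinal (leq_maxr (size P) n.+1))) //=.
  rewrite coef_tmapX coefCM coefXn eqxx mulr1 big1 ?addr0 // => l ln.
  rewrite coef_tmapX coefCM coefXn eqn_exp2l ?finNzRing_gt1 // eq_sym.
  by rewrite -val_eqE /= in ln; rewrite (negPf ln) mulr0.
by rewrite -!coefT eqUV.
Qed.

End Representations.


(** * Isomorphisms and transport of structure *)

Section Isomorphisms.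
Variables (F : finFieldType) (R : comNzRingType) (g : {rmorphism {poly F} -> R}).

(** [F[t]] is generated by t over [F], and the images of the scalars from [F] commute with all
    twisted polynomials. *)
Lemma tm_morphismX d e (Phi : tmodule g d) (Psi : tmodule g e) U :
  U *m Phi 'X = Psi 'X *m U -> tm_morphism Phi Psi U.
Proof.
move=> UX; elim/poly_ind => [|p c IHp]; first by rewrite !rmorph0 mulmx0 mul0mx.
rewrite !rmorphD !rmorphM /= -!mulmxE mulmxDr mulmxDl mulmxA IHp -!mulmxA UX.
congr (_ + _); rewrite !tm_scalar mul_scalar_mx.
apply/matrixP => i j; rewrite !mxE (bigD1 j) //= big1 => [|k /negPf kj].
  by rewrite mxE eqxx mulr1n addr0 tC_scalar_comm.
by rewrite mxE kj mulr0.
Qed.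

Lemma tm_iso_inverse d e (Phi : tmodule g d) (Psi : tmodule g e) :
    tm_iso Phi Psi ->
  exists V W, [/\ W *m V = 1%:M, V *m W = 1%:M, tm_morphism Phi Psi V
    & tm_morphism Psi Phi W].
Proof.
case=> V [W [WV VW morV]]; exists V, W; split=> // a.
rewrite -[LHS]mulmx1 -VW -mulmxA (mulmxA _ V) -morV.
by rewrite !mulmxA WV mul1mx.
Qed.

Lemma tm_iso_sym d e (Phi : tmodule g d) (Psi : tmodule g e) :
  tm_iso Phi Psi -> tm_iso Psi Phi.
Proof. by case/tm_iso_inverse=> V [W [WV VW _ morW]]; exists W, V. Qed.

Lemma tm_iso_trans d e m (Phi : tmodule g d) (Psi : tmodule g e)
    (Xi : tmodule g m) : tm_iso Phi Psi -> tm_iso Psi Xi -> tm_iso Phi Xi.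
Proof.
case=> V [W [WV VW morV]] [V' [W' [WV' VW' morV']]].
exists (V' *m V), (W *m W'); split=> [||a].
- by rewrite mulmxA -(mulmxA W) WV' mulmx1.
- by rewrite mulmxA -(mulmxA V') VW mulmx1.
- by rewrite -mulmxA morV mulmxA morV' mulmxA.
Qed.

(** The constant term of Psi_t is a conjugate of the scalar matrix theta, hence equal to it. *)
Lemma no_nilpotence_iso d e (Phi : tmodule g d) (Psi : tmodule g e) :
  tm_iso Phi Psi -> no_nilpotence Phi -> no_nilpotence Psi.
Proof.
move=> [V [W [_ VW morV]]] nilPhi; rewrite /no_nilpotence.
rewrite -[Psi 'X]mulmx1 -VW mulmxA -morV -mulmxA !map_mxM nilPhi /=.
by rewrite mul_scalar_mx -scalemxAr -map_mxM VW map_mx1 scalemx1.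
Qed.

Lemma no_nilpotence_base (S : comNzRingType) (f : {rmorphism R -> S}) d
    (Phi : tmodule g d) : no_nilpotence Phi -> no_nilpotence (tm_base f Phi).
Proof.
move=> /matrixP Phi0; apply/matrixP => i j; have := Phi0 i j.
by rewrite !mxE /tdiff coef_tmap => ->; rewrite rmorphMn.
Qed.

(** On constant terms the two summands of an inner biderivation are both theta times the constant
    term of [U], so they cancel. *)
Lemma Der_in_Der0 d (Phi : tmodule g d) (x : 'rV_d) :
  no_nilpotence Phi -> Der_in Phi (carlitz g) x -> Der0 x.
Proof.
move=> Phi0 [U ->]; rewrite /Der0 map_mxB !map_mxM /= Phi0 carlitzX.
rewrite map_scalar_mx /= (_ : tdiff g _ = g 'X) ?scalar_mxC ?subrr //.
by rewrite /tdiff coef_skewD coefC coefX addr0.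
Qed.

Lemma inner_mulr z d e (Phi : tmodule g d) (Psi : tmodule g e) V x :
  V *m Phi 'X = Psi 'X *m V -> inner z Psi x -> inner z Phi (x *m V).
Proof.
move=> morV [[U ->] x0]; split=> [|zT]; last exact: Der0_mulr (x0 zT).
by exists (U *m V); rewrite mulmxBl -!mulmxA morV.
Qed.

End Isomorphisms.

Section Transport.
Variables (F : finFieldType) (R : comNzRingType) (g : {rmorphism {poly F} -> R}).

(** [V] and [W] convert coordinates for one basis into coordinates for the other. Uniqueness of
    representatives over every [S] makes them mutually inverse on points, and compatible with t
    because both actions represent multiplication by C_t; [mx_points_inj] turns this into matrix
    identities. *)
Lemma z_structure_unique (z : bool) d m m' (Phi : tmodule g d) (b : 'M_(m, d))
    (b' : 'M_(m', d)) (E : tmodule g m) (E' : tmodule g m') :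
    z_structure z Phi b (E 'X) -> z_structure z Phi b' (E' 'X) ->
  tm_iso E E'.
Proof.
move=> [rep_b bE] [rep_b' bE'].
have [V VP] := represents_linear rep_b' rep_b.1.
have [W WP] := represents_linear rep_b rep_b'.1.
exists V, W; split; last apply: tm_morphismX;
  apply: mx_points_inj => S f c; rewrite !map_mxM ?map_mx1 ?mx_points1 !mx_pointsM.
- by apply/esym/(represents_inj rep_b)/(inner_trans (VP S f c))/WP.
- by apply/esym/(represents_inj rep_b')/(inner_trans (WP S f c))/VP.
apply: (represents_inj rep_b').
apply: inner_trans (inner_sym (VP _ _ _)) _.
apply: inner_trans (inner_sym (bE _ _ _)) _.
exact: inner_trans (inner_carlitz (VP _ _ _)) (bE' _ _ _).
Qed.

(** An isomorphism of the source acts on biderivations by right multiplication, which commutes with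
    C_t. Only the basis changes; the coordinates and [E] stay the same. *)
Lemma z_structure_iso (z : bool) d e m (Phi : tmodule g d) (Psi : tmodule g e)
    (b : 'M_(m, d)) (E : 'M_m) :
    tm_iso Phi Psi -> z_structure z Phi b E ->
  exists b' : 'M_(m, e), z_structure z Psi b' E.
Proof.
move=> /tm_iso_inverse[V [W [WV VW morV morW]]] [[b0 rb] bE].
exists (b *m W).
have repW (S : comNzRingType) (f : {rmorphism R -> S}) c :
    Der_rep (b *m W) f c = Der_rep b f c *m map_mx (tmap g f) W.
  by rewrite /Der_rep map_mxM mulmxA.
split; first split=> [zT|S f delta delta0]; first exact: Der0_mulr (b0 zT).
- have [zT|c [ic uniq_c]] := rb S f (delta *m map_mx (tmap g f) V).
    exact: Der0_mulr (delta0 zT).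
  exists c; split=> [|c' ic'].
    rewrite repW -[delta]mulmx1 -[1%:M](map_mx1 (tmap g f)) -VW map_mxM mulmxA.
    rewrite -mulmxBl; apply: inner_mulr ic.
    by rewrite /= -!map_mxM morW.
  apply: uniq_c.
  rewrite -[X in _ - X]mulmx1 -[1%:M](map_mx1 (tmap g f)) -WV map_mxM mulmxA.
  rewrite -repW -mulmxBl; apply: inner_mulr ic'.
  by rewrite /= -!map_mxM morV.
- move=> S f c; rewrite !repW mulmxA -mulmxBl; apply: inner_mulr (bE _ _ _).
  by rewrite /= -!map_mxM morW.
Qed.

Lemma tm_exact_iso d d' m m' e (Phi : tmodule g d) (Phi' : tmodule g d')
    (E : tmodule g m) (E' : tmodule g m') (Psi : tmodule g e) :
    tm_iso Phi Phi' -> tm_iso E E' ->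
  tm_exact Phi E Psi -> tm_exact Phi' E' Psi.
Proof.
move=> /tm_iso_inverse[V1 [W1 [WV1 VW1 morV1 morW1]]].
move=> /tm_iso_inverse[V2 [W2 [WV2 VW2 morV2 morW2]]].
case=> u [v [moru morv exS]]; exists (V2 *m u *m W1), (v *m W2); split.
- by move=> a; rewrite -!mulmxA morW1 (mulmxA u) moru !mulmxA morV2.
- by move=> a; rewrite -mulmxA morW2 mulmxA morv mulmxA.
move=> S f /=; have [inj_u ex_v sur_v] := exS S f.
have ptM k l h (U : 'M[tpoly g]_(k, l)) (U' : 'M_(l, h)) x :
    mx_points (map_mx (tmap g f) (U *m U')) x
    = mx_points (map_mx (tmap g f) U) (mx_points (map_mx (tmap g f) U') x).
  by rewrite map_mxM mx_pointsM.
have pt1 k (U : 'M[tpoly g]_k) x :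
    U = 1%:M -> mx_points (map_mx (tmap g f) U) x = x.
  by move->; rewrite map_mx1 mx_points1.
split=> [x y|y|w].
- rewrite !ptM => /(congr1 (mx_points (map_mx (tmap g f) W2))).
  rewrite -!(ptM _ _ _ W2) !(pt1 _ _ _ WV2).
  move/inj_u/(congr1 (mx_points (map_mx (tmap g f) V1))).
  by rewrite -!(ptM _ _ _ V1) !(pt1 _ _ _ VW1).
- rewrite ptM; split=> [/ex_v[x eq_x]|[x ->]].
    exists (mx_points (map_mx (tmap g f) V1) x).
    rewrite !ptM -(ptM _ _ _ W1) (pt1 _ _ _ WV1) -eq_x -(ptM _ _ _ V2).
    by rewrite (pt1 _ _ _ VW2).
  apply/ex_v; exists (mx_points (map_mx (tmap g f) W1) x).
  by rewrite -!ptM !mulmxA WV2 mul1mx.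
have [y <-] := sur_v w; exists (mx_points (map_mx (tmap g f) V2) y).
by rewrite -ptM -mulmxA WV2 mulmx1.
Qed.

End Transport.


(** * Ext^1 as an extension of constant biderivations by the dual *)

Section ConstantRepresentatives.
Variables (F : finFieldType) (R : comNzRingType) (g : {rmorphism {poly F} -> R}).

Lemma tdiff_tau : tdiff g (tau g) = 0.
Proof. by rewrite /tdiff coefX. Qed.

Lemma tdiff_tC a : tdiff g (tC g a) = a.
Proof. by rewrite /tdiff coefC. Qed.

Lemma tmap_tau (S : comNzRingType) (f : {rmorphism R -> S}) :
  tmap g f (tau g) = tau (abase g f).
Proof. exact: smap_tau (abase g f) f. Qed.

Lemma tmap_tC (S : comNzRingType) (f : {rmorphism R -> S}) a :
  tmap g f (tC g a) = tC (abase g f) (f a).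
Proof. exact: smap_tC (abase g f) f a. Qed.

Lemma teval_tau x : teval (tau g) x = frobq g x.
Proof.
by rewrite -[tau g]mulr1 teval_tauM -(rmorph1 (tC g)) teval_tC mul1r.
Qed.

Lemma rep_col d m m' (b : 'M[tpoly g]_(m, d)) (b' : 'M_(m', d)) y w :
  rep (col_mx b b') (col_mx y w) = rep b y + rep b' w.
Proof. by rewrite !repE tr_col_mx map_row_mx mul_row_col. Qed.

Lemma rep1 m w : rep (1%:M : 'M[tpoly g]_m) w = map_mx (tC g) w^T.
Proof. by rewrite repE mulmx1. Qed.

(** From tau w = w^q tau: multiplying a constant biderivation by C_t leaves the constants through
    the term in [tau]. *)
Lemma carlitz_rep1 m (w : 'cV_m) :
  carlitz g 'X *m rep 1%:M w =
  rep 1%:M (g 'X *: w) + rep (tau g)%:M (map_mx (frobq g) w).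
Proof.
rewrite carlitzX mul_scalar_mx !rep1 repE; apply/matrixP => i j; rewrite !mxE.
rewrite (bigD1 j) //= big1 => [|l /negPf lj]; last by rewrite !mxE lj mulr0.
rewrite !mxE eqxx mulr1n addr0 (ord1 i) rmorphM mulrDl; congr (_ + _).
apply: skewP => -[|k]; rewrite coef_tauM coef_Mtau // !coefC.
by case: eqP => // _; apply: frobq0 g.
Qed.

Lemma tdiff_rep1 m (w : 'cV_m) : map_mx (tdiff g) (rep 1%:M w) = w^T.
Proof. by rewrite rep1; apply/matrixP => i j; rewrite !mxE /tdiff coefC. Qed.

Lemma Der_in_inner z d (Phi : tmodule g d) (x : 'rV_d) :
  no_nilpotence Phi -> Der_in Phi (carlitz g) x -> inner z Phi x.
Proof. by move=> nilPhi ix; split=> // _; apply: Der_in_Der0 ix. Qed.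

End ConstantRepresentatives.

Section ExtOfDual.
Variables (F : finFieldType) (R : comNzRingType) (g : {rmorphism {poly F} -> R}).
Variables (n N : nat) (D : tmodule g N) (Phi : tmodule g n) (b : 'M[tpoly g]_(n, N)).
Hypotheses (nilD : no_nilpotence D) (nilPhi : no_nilpotence Phi).
Hypothesis bPhi : z_structure true D b (Phi 'X).

(** The dual is enlarged by the constant biderivations to give all of Ext^1. *)
Let b1 := col_mx b (1%:M : 'M[tpoly g]_N).

Lemma Der_rep_block (S : comNzRingType) (f : {rmorphism R -> S}) y w :
  Der_rep b1 f (col_mx y w) = Der_rep b f y + rep 1%:M w.
Proof. by rewrite !Der_repE map_col_mx map_mx1 rep_col. Qed.

(** Inner biderivations of [D] have no constant term, so the constant term [w] of [delta] depends
    only on its class; what remains after subtracting it is a class in the dual. *)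
Lemma represents_block : represents false D b1.
Proof.
have [[b0 rb] _] := bPhi; split=> // S f delta _.
pose w := (map_mx (tdiff (abase g f)) delta)^T.
have [_|y [iy uniq_y]] := rb S f (delta - rep 1%:M w).
  by rewrite /Der0 map_mxB tdiff_rep1 trmxK subrr.
exists (col_mx y w); split=> [|c].
  by split=> //; have [+ _] := iy; rewrite Der_rep_block opprD addrA addrAC.
rewrite -[c]vsubmxK; move: (usubmx c) (dsubmx c) => y' w' {c} [ic _].
have nilDS := no_nilpotence_base f nilD.
have := Der_in_inner true nilDS ic.
rewrite Der_rep_block opprD addrA addrAC => iyw.
have eqw : w' = w.
  have := iyw.2 isT; rewrite /Der0 !map_mxB tdiff_rep1.
  have : Der0 (Der_rep b f y') by apply: Der_rep0 (isT) => _; apply: b0.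
  rewrite /Der0 => -> /eqP; rewrite subr0 subr_eq0 => /eqP dw.
  by rewrite /w dw trmxK.
rewrite eqw in iyw *; congr col_mx.
exact: uniq_y iyw.
Qed.

Lemma Ext_of_dual :
  exists E : tmodule g (n + N),
    (exists b', z_structure false D b' (E 'X)) /\ tm_exact Phi E (Ga g N).
Proof.
(* [V] gives the dual coordinates of the biderivations w tau, which arise when C_t acts on
   constants. *)
have [V VP] : exists V : 'M[tpoly g]_(n, N),
    forall (S : comNzRingType) (f : {rmorphism R -> S}) c,
    inner true (tm_base f D) (Der_rep (tau g)%:M f c
      - Der_rep b f (mx_points (map_mx (tmap g f) V) c)).
  apply: represents_linear bPhi.1 _ => _; rewrite /Der0 map_scalar_mx /=.
  by rewrite tdiff_tau raddf0.
(* On a constant w, t acts by theta w plus the class of w^q tau; the Frobenius is applied before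
   [V], hence the off-diagonal block [V *m (tau g)%:M]. *)
pose T := block_mx (Phi 'X) (V *m (tau g)%:M) 0 (tC g (g 'X))%:M.
have T0 : map_mx (tdiff g) T = (g 'X)%:M.
  rewrite /T map_block_mx nilPhi map_mxM !map_scalar_mx map_mx0 /=.
  by rewrite tdiff_tau tdiff_tC raddf0 mulmx0 -scalar_mx_block.
have T_tangent : tangent T.
  by exists 0; split; [exists 1%N; rewrite expr1 | rewrite addr0].
have TX : tmodule_of T_tangent 'X = T by apply: tm_evalX.
have GaX : Ga g N 'X = (tC g (g 'X))%:M by apply: tm_evalX.
exists (tmodule_of T_tangent); split.
  exists b1; split; first exact: represents_block.
  move=> S f c; rewrite -[c]vsubmxK; move: (usubmx c) (dsubmx c) => y w {c}.
  rewrite TX /T map_block_mx -[block_mx _ _ _ _]/(col_mx _ _).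
  rewrite mx_points_col !mx_points_row map_mx0 mx_points0 add0r map_mxM.
  rewrite mx_pointsM !map_scalar_mx /= !Der_rep_block mulmxDr.
  rewrite tmap_tau tmap_tC !mx_points_scalar.
  rewrite (_ : \col_i teval (tau _) _ = map_mx (frobq (abase g f)) w); last first.
    by apply/matrixP => i j; rewrite !mxE (ord1 j) teval_tau.
  rewrite (_ : \col_i teval (tC _ _) _ = abase g f 'X *: w); last first.
    by apply/matrixP => i j; rewrite !mxE (ord1 j) teval_tC.
  rewrite carlitz_rep1; split=> //.
  set w' := map_mx _ w; have := (innerD (bPhi.2 S f y) (VP S f w')).1.
  rewrite [Der_rep (tau g)%:M _ _]Der_repE map_scalar_mx /= tmap_tau.
  rewrite !(Der_repE b) repD.
  have addE (M : zmodType) (x p r x' r' : M) :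
      x + (p + r) - (x' + r' + p) = x - x' + (r - r').
    by rewrite [p + r]addrC addrA [x' + r' + p]addrC addrKA opprD addrACA.
  by rewrite addE.
exists (col_mx 1%:M 0), (row_mx 0 1%:M); split.
- apply: tm_morphismX; rewrite TX mul_block_col mul_col_mx.
  by rewrite !mul1mx !mul0mx !mulmx1 !mulmx0 !addr0.
- apply: tm_morphismX; rewrite TX GaX mul_row_block mul_mx_row.
  by rewrite !mul1mx !mul0mx !mulmx1 !mulmx0 !add0r.
move=> S f /=; rewrite map_col_mx map_row_mx !map_mx1 !map_mx0.
have uE x : mx_points (col_mx 1%:M 0) x = col_mx x 0 :> 'cV[S]_(n + N).
  by rewrite mx_points_col mx_points1 mx_points0.
have vE x y : mx_points (row_mx 0 1%:M) (col_mx x y) = y :> 'cV[S]_N.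
  by rewrite mx_points_row mx_points1 mx_points0 add0r.
split=> [x y|y|w].
- by rewrite !uE => /eq_col_mx[].
- rewrite -[y]vsubmxK; move: (usubmx y) (dsubmx y) => y1 y2; rewrite vE.
  split=> [->|[x]]; first by exists y1; rewrite uE.
  by rewrite uE => /eq_col_mx[].
by exists (col_mx 0 w); rewrite vE.
Qed.

End ExtOfDual.


(** * Division with remainder and the dual of a reduced module *)

Section Slots.
Variables (n : nat) (r : 'I_n -> nat).

(* The slot (j, i) carries the coordinate of tau^(i+1) e_j. *)
Definition slot := {j : 'I_n & 'I_(r j).-1}.
Local Notation N := #|{: slot}|.

Definition lab (p : 'I_N) : 'I_n := tag (enum_val p).
Definition idx (p : 'I_N) : nat := tagged (enum_val p).

(** The default 0 out of range encodes that a companion chain stops: the successor of the last slot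
    of a block contributes nothing. *)
Definition entry (V : zmodType) (x : 'I_N -> V) (j : 'I_n) (i : nat) : V :=
  if insub i is Some o
  then x (enum_rank (Tagged (fun j => 'I_(r j).-1) (o : 'I_(r j).-1))) else 0.

Lemma idx_lt p : (idx p < (r (lab p)).-1)%N.
Proof. exact: ltn_ord. Qed.

Lemma slotP j i : (i < (r j).-1)%N -> exists p, lab p = j /\ idx p = i.
Proof.
move=> lt_i; exists (enum_rank (Tagged (fun j => 'I_(r j).-1) (Ordinal lt_i))).
by rewrite /lab /idx enum_rankK.
Qed.

Lemma entryE (V : zmodType) (x : 'I_N -> V) p : entry x (lab p) (idx p) = x p.
Proof.
rewrite /entry /lab /idx; case E: (enum_val p) => [j o] /=.
by rewrite valK -[in RHS](enum_valK p) E.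
Qed.

Lemma entry_out (V : zmodType) (x : 'I_N -> V) j i :
  ((r j).-1 <= i)%N -> entry x j i = 0.
Proof. by move=> le_i; rewrite /entry insubN // -leqNgt. Qed.

Lemma slot_eq p p' : (p == p') = (lab p == lab p') && (idx p == idx p').
Proof.
apply/eqP/andP=> [-> //|[/eqP eq_lab /eqP]]; apply: contra_eq => /eqP ne_pp'.
apply/negP => /eqP eq_idx; case: ne_pp'; apply: enum_val_inj; move: eq_lab eq_idx.
rewrite /lab /idx; case: (enum_val p) (enum_val p') => [j o] [j' o'] /= eq_j.
by case: j' / eq_j o' => o' /val_inj->.
Qed.

Lemma sum_slot (V : nmodType) (G : 'I_n -> nat -> V) :
  \sum_p G (lab p) (idx p) = \sum_j \sum_(i < (r j).-1) G j i.
Proof.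
rewrite (sig_big_dep _ _ (fun j (i : 'I_(r j).-1) => G j i)) /=.
rewrite (reindex enum_rank) /=; last by apply: onW_bij; apply: enum_rank_bij.
by apply: eq_bigr => s _; rewrite /lab /idx enum_rankK.
Qed.

Lemma sum_entry (V W : zmodType) (x : 'I_N -> V) (G : 'I_n -> nat -> V -> W) :
  \sum_p G (lab p) (idx p) (x p) =
  \sum_j \sum_(i < (r j).-1) G j i (entry x j i).
Proof.
rewrite -(sum_slot (fun j i => G j i (entry x j i))).
by apply: eq_bigr => p _; rewrite entryE.
Qed.

(** Collapses the sums with indicators that come from companion blocks; out of range both sides are
    0. *)
Lemma sum_slot_pick (V : zmodType) (x : 'I_N -> V) l h :
  \sum_p x p *+ ((lab p == l) && (idx p == h)) = entry x l h.
Proof.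
have [lt_h|le_h] := ltnP h (r l).-1; last first.
  rewrite entry_out // big1 // => p _; case: eqP => //= lab_p.
  by rewrite ltn_eqF // (leq_trans (idx_lt p)) // lab_p.
have [p [<- <-]] := slotP lt_h; rewrite (bigD1 p) //= !eqxx entryE big1 ?addr0 //.
by move=> p' ne_p; rewrite -slot_eq (negPf ne_p).
Qed.

Hypothesis r_gt1 : forall l, (1 < r l)%N.

Lemma last_lt l : ((r l).-2 < (r l).-1)%N.
Proof. by case: (r l) (r_gt1 l) => [|[]]. Qed.

(** Block [l] has slots 0, ..., r_l - 2, so [i.+2 == r l] singles out its last slot; here r_l > 1
    ensures that the block is nonempty. *)
Lemma last_slotE l i : (i.+2 == r l) = (i == (r l).-2).
Proof. by case: (r l) (r_gt1 l) => [|[]]. Qed.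

Lemma sum_last (V : nmodType) (G : 'I_n -> nat -> V) :
  \sum_j \sum_(i < (r j).-1) G j i *+ (i.+2 == r j) = \sum_j G j (r j).-2.
Proof.
apply: eq_bigr => j _; rewrite (bigD1 (Ordinal (last_lt j))) //= last_slotE eqxx.
rewrite big1 ?addr0 // => i; rewrite -val_eqE /= => /negPf ne_i.
by rewrite last_slotE ne_i.
Qed.

Lemma card_slot : N = (\sum_(l < n) r l - n)%N.
Proof.
transitivity (\sum_(p < N) 1)%N; first by rewrite sum1_card card_ord.
rewrite [LHS](sum_slot (fun _ _ => 1%N)).
transitivity (\sum_(l < n) (r l - 1))%N.
  by apply: eq_bigr => l _; rewrite sum1_card card_ord subn1.
rewrite sumnB => [|l _]; last exact: ltnW.
by rewrite sum1_card card_ord.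
Qed.

End Slots.

Section Division.
Variables (F : finFieldType) (R : comNzRingType) (g : {rmorphism {poly F} -> R}).
Local Notation q := #|F|.

Lemma coef_skewM_gt k e (P Q : tpoly g) i :
    (forall m, (k < m)%N -> P`_m = 0) -> (forall m, (e < m)%N -> Q`_m = 0) ->
  (k + e < i)%N -> (P * Q)`_i = 0.
Proof.
move=> P_k Q_e lt_i; rewrite coef_skewM big1 // => m _; rewrite iter_frobq.
have [lt_m|le_m] := ltnP k m; first by rewrite P_k ?mul0r.
rewrite Q_e ?expr0n ?expn_eq0 ?eqn0Ngt ?(ltnW (finNzRing_gt1 F)) ?mulr0 //.
by rewrite ltn_subRL (leq_ltn_trans _ lt_i) // leq_add2r.
Qed.

Lemma coef_skewM_top k e (P Q : tpoly g) :
    (forall m, (k < m)%N -> P`_m = 0) -> (forall m, (e < m)%N -> Q`_m = 0) ->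
  (P * Q)`_(k + e) = P`_k * Q`_e ^+ (q ^ k).
Proof.
move=> P_k Q_e; rewrite coef_skewM.
have lt_k : (k < (k + e).+1)%N by rewrite ltnS leq_addr.
rewrite (bigD1 (Ordinal lt_k)) //= addKn iter_frobq big1 ?addr0 // => m.
rewrite -val_eqE /= => ne_m; rewrite iter_frobq.
have [lt_m|le_m] := ltnP k m; first by rewrite P_k ?mul0r.
rewrite Q_e ?expr0n ?expn_eq0 ?eqn0Ngt ?(ltnW (finNzRing_gt1 F)) ?mulr0 //.
by rewrite ltn_subRL ltn_add2r ltn_neqAle ne_m.
Qed.

Variables (n : nat) (L : 'rV[tpoly g]_n -> 'rV[tpoly g]_n) (e : 'I_n -> nat).
Variables (u v : nat -> 'I_n -> R).
Hypothesis uv : forall k j, v k j * u k j = 1.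
Hypothesis LB : forall U V, L (U - V) = L U - L V.
Hypothesis L_gt : forall k (U : 'rV[tpoly g]_n),
  (forall j i, (k < i)%N -> (U 0 j)`_i = 0) ->
  forall j i, (k + e j < i)%N -> (L U 0 j)`_i = 0.
Hypothesis L_top : forall k (U : 'rV[tpoly g]_n),
  (forall j i, (k < i)%N -> (U 0 j)`_i = 0) ->
  forall j, (L U 0 j)`_(k + e j) = (U 0 j)`_k * u k j.

(** Induction on the excess [m] of the degrees of [delta] over [e], cancelling the top coefficients
    of all columns at once. It is applied with [e] equal to the ranks for the dual, and to the
    constant 2 for the double dual. *)
Lemma division_exists delta :
  exists U, forall j i, (e j <= i)%N -> ((delta - L U) 0 j)`_i = 0.
Proof.
have [m] : exists m, forall j i, (m + e j <= i)%N -> (delta 0 j)`_i = 0.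
  exists (\max_j size (delta 0%R j))%N => j i le_i.
  rewrite nth_default // (leq_trans _ le_i) //.
  by rewrite (leq_trans _ (leq_addr _ _)) //; apply: (bigmax_sup j).
elim: m delta => [|m IHm] delta delta_m.
  exists 0; have := LB 0 0; rewrite !subrr => ->; rewrite subr0.
  by move=> j i le_i; apply: delta_m.
(* A homogeneous quotient of degree [m]: the excess top coefficients divided by the units
   [u m j]. *)
pose U := \row_j (tC g ((delta 0 j)`_(m + e j) * v m j) * tau g ^+ m).
have U_m j i : (U 0 j)`_i = ((delta 0 j)`_(m + e j) * v m j) * (i == m)%:R.
  by rewrite mxE coef_tCM coef_tau_exp.
have U_gt j i : (m < i)%N -> (U 0 j)`_i = 0.
  by move=> lt_i; rewrite U_m gtn_eqF ?mulr0.
have [|V VP] := IHm (delta - L U).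
  move=> j i; rewrite !mxE coef_skewB leq_eqVlt => /predU1P[<-|lt_i].
    by rewrite L_top // U_m eqxx mulr1 -mulrA uv mulr1 subrr.
  by rewrite (L_gt U_gt) // delta_m ?subr0.
(* The hypothesis on [L] concerns differences, so the sum is written as [U - - V]. *)
exists (U + V) => j i le_i; rewrite -[V]opprK LB.
have := LB 0 V; have := LB 0 0; rewrite !subrr => ->; rewrite !sub0r => ->.
by rewrite opprK opprD addrA; apply: VP.
Qed.

(** The top coefficient of [U] times a unit is a coefficient of [L U] in degree at least [e j],
    hence zero; descend on the degree. *)
Lemma division_unique (U : 'rV[tpoly g]_n) :
  (forall j i, (e j <= i)%N -> (L U 0 j)`_i = 0) -> U = 0.
Proof.
move=> LU; have [m] : exists m, forall j i, (m <= i)%N -> (U 0 j)`_i = 0.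
  exists (\max_j size (U 0%R j))%N => j i le_i.
  rewrite nth_default // (leq_trans _ le_i) //.
  exact: (bigmax_sup j).
elim: m => [|m IHm] U_m.
  apply/matrixP => i j; rewrite (ord1 i); apply: skewP => k.
  by rewrite U_m // mxE coef_skew0.
apply: IHm => j i; rewrite leq_eqVlt => /predU1P[<-|]; last exact: U_m.
rewrite -[LHS]mulr1 -(uv m j) [v m j * _]mulrC mulrA -L_top //.
by rewrite LU ?mul0r // leq_addl.
Qed.

End Division.


Section ColumnReduced.
Variables (F : finFieldType) (R : comNzRingType) (g : {rmorphism {poly F} -> R}).
Variables (n : nat) (r : 'I_n -> nat).
Local Notation q := #|F|.
Local Notation N := #|{: slot r}|.

(** The form in which the LD condition and the absence of nilpotence enter: column [j] has degree at
    most [r j], the matrix of coefficients at these degrees is diagonal, and the constant term is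
    theta. *)
Definition column_reduced (a : 'I_n -> R) (T : 'M[tpoly g]_n) : Prop :=
  forall i j, [/\ (T i j)`_0 = g 'X *+ (i == j), (T i j)`_(r j) = a j *+ (i == j)
    & forall k, (r j < k)%N -> (T i j)`_k = 0].

Lemma coef_skewMb (P : tpoly g) (b : bool) k : (P *+ b)`_k = P`_k *+ b.
Proof. by case: b; rewrite ?mulr1n // !mulr0n coef_skew0. Qed.

Lemma coef_mxB m d (x y : 'M[tpoly g]_(m, d)) i j k :
  ((x - y) i j)`_k = (x i j)`_k - (y i j)`_k.
Proof. by rewrite !mxE coef_skewB. Qed.

Lemma coef_carlitz d (x : 'rV[tpoly g]_d) j k :
  ((carlitz g 'X *m x) 0 j)`_k =
  g 'X * (x 0 j)`_k + (if k is i.+1 then (x 0 j)`_i ^+ q else 0).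
Proof.
by rewrite carlitzX mul_scalar_mx mxE mulrDl coef_skewD coef_tCM coef_tauM.
Qed.

Lemma entry_frobq (x : 'I_N -> R) j i :
  entry (fun p => x p ^+ q) j i = entry x j i ^+ q.
Proof. by rewrite /entry; case: insub => //; rewrite (frobq0 g). Qed.

Definition dual_basis : 'M[tpoly g]_(N, n) :=
  \matrix_(p, j) (tau g ^+ (idx p).+1 *+ (lab p == j)).

Lemma coef_rep_dual c j k :
  (rep dual_basis c 0 j)`_k = if k is i.+1 then entry (c^~ 0) j i else 0.
Proof.
rewrite coef_rep; case: k => [|i].
  rewrite big1 // => p _.
  by rewrite mxE coef_skewMb coef_tau_exp mul0rn mulr0.
rewrite -sum_slot_pick; apply: eq_bigr => p _.
rewrite mxE coef_skewMb coef_tau_exp eqSS eq_sym.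
by case: (lab p == j); case: (idx p == i); rewrite ?mulr1 ?mulr0.
Qed.

Lemma Der0_dual_basis : Der0 dual_basis.
Proof.
by apply/matrixP => p j; rewrite !mxE /tdiff coef_skewMb coef_tau_exp mul0rn.
Qed.

Variables (a a' : 'I_n -> R).
Hypothesis aK : forall j, a j * a' j = 1.
Hypothesis r_gt1 : forall l, (1 < r l)%N.

(** Multiplication by tau moves slot (j,i) to (j,i+1). From the last slot it reaches tau^(r_j),
    which is removed by subtracting U T - C_t U with U = a_j^-1 c^q e_j: the part U T brings in row
    [j] of [T], and tau U = U^q tau gives the term in tau^2 at slot 0. *)
Definition dual_mx (T : 'M[tpoly g]_n) : 'M[tpoly g]_N :=
  \matrix_(p', p)
   (tC g (g 'X *+ (p' == p))
    + tC g (((lab p' == lab p) && (idx p' == (idx p).+1))%:R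
            - ((T (lab p) (lab p'))`_(idx p').+1 * a' (lab p))
              *+ ((idx p).+2 == r (lab p))) * tau g
    + tC g ((a' (lab p) ^+ q *+ ((lab p' == lab p) && (idx p' == 0%N)))
            *+ ((idx p).+2 == r (lab p))) * tau g ^+ 2).

(* The leading coefficients of the U for which U T - C_t U reduces
   C_t * delta. *)
Definition quot_last (c : 'cV[R]_N) j := a' j * entry (c^~ 0) j (r j).-2 ^+ q.

Lemma dual_mx_points T c p :
  mx_points (dual_mx T) c p 0 =
  g 'X * c p 0
  + (if idx p is i.+1 then entry (c^~ 0) (lab p) i ^+ q else 0)
  - \sum_j (T j (lab p))`_(idx p).+1 * quot_last c j
  + quot_last c (lab p) ^+ q *+ (idx p == 0%N).
Proof.
set l := lab p; set h := idx p; rewrite mxE.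
under eq_bigr => s _.
  rewrite mxE !tevalD -/l -/h teval_tC !teval_tCM teval_tau expr2 tevalM.
  rewrite !teval_tau /frobq mulrBl.
over.
rewrite !big_split /= !addrA; congr (_ + _ + _ + _).
- rewrite (bigD1 p) //= eqxx big1 ?addr0 // => s /negPf ne_s.
  by rewrite eq_sym ne_s mulr0n mul0r.
- case: h => [|h]; first by rewrite big1 // => s _; rewrite andbF mul0r.
  rewrite -entry_frobq -sum_slot_pick; apply: eq_bigr => s _.
  by rewrite eqSS mulr_natl eq_sym [h == _]eq_sym.
- rewrite sumrN; congr (- _).
  pose G j i x := ((T j l)`_h.+1 * a' j * x ^+ q) *+ (i.+2 == r j).
  rewrite (eq_bigr (fun s => G (lab s) (idx s) (c s 0))) => [|s _]; last first.
    by rewrite /G mulrnAl.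
  rewrite sum_entry.
  rewrite (sum_last r_gt1
    (fun j i => (T j l)`_h.+1 * a' j * entry (c^~ 0) j i ^+ q)).
  by apply: eq_bigr => j _; rewrite mulrA.
pose G j i x :=
  (a' j ^+ q * (x ^+ q) ^+ q *+ ((l == j) && (h == 0%N))) *+ (i.+2 == r j).
rewrite (eq_bigr (fun s => G (lab s) (idx s) (c s 0))) => [|s _]; last first.
  by rewrite /G !mulrnAl.
rewrite sum_entry.
rewrite (sum_last r_gt1 (fun j i => a' j ^+ q * (entry (c^~ 0) j i ^+ q) ^+ q
  *+ ((l == j) && (h == 0%N)))).
rewrite (bigD1 l) //= eqxx big1 ?addr0 => [|j]; last first.
  by rewrite eq_sym => /negPf->.
by rewrite /quot_last exprMn.
Qed.

Variables (Phi : tmodule g n).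
Hypothesis Phi_red : column_reduced a (Phi 'X).
Local Notation T := (Phi 'X).

Lemma column_reduced_no_nilpotence : no_nilpotence Phi.
Proof.
apply/matrixP => i j; have [T0 _ _] := Phi_red i j.
by rewrite !mxE /tdiff T0.
Qed.

Lemma dual_action c :
  Der_in Phi (carlitz g) (carlitz g 'X *m rep dual_basis c
    - rep dual_basis (mx_points (dual_mx T) c)).
Proof.
exists (\row_j tC g (quot_last c j)).
apply/matrixP => i l; rewrite (ord1 i) {i}; apply: skewP => k.
have UT : ((\row_j tC g (quot_last c j) *m T) 0 l)`_k =
    \sum_j (T j l)`_k * quot_last c j.
  rewrite mxE coef_skew_sum; apply: eq_bigr => j _.
  by rewrite mxE coef_tCM mulrC.
rewrite !coef_mxB UT.
rewrite (coef_carlitz (rep dual_basis c)) (coef_carlitz (\row_j _)).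
rewrite (coef_rep_dual c) (coef_rep_dual (mx_points _ c)) mxE coefC.
(* In degree 0 the two copies of theta times the quotient cancel. *)
case: k {UT} => [|k] /=.
  rewrite mulr0 !addr0 subr0 (bigD1 l) //= big1 => [|j /negPf jl].
    by have [-> _ _] := Phi_red l l; rewrite eqxx addr0 subrr.
  by have [-> _ _] := Phi_red j l; rewrite jl mul0r.
rewrite mulr0 add0r coef_rep_dual coefC.
(* The coefficient under study is that of tau^(k+1). Below r_l it is the formula for [dual_mx]; at
   r_l the choice of [quot_last] matches it; above r_l everything vanishes. *)
have [lt_k|] := ltnP k (r l).-1.
  have [p [lp kp]] := slotP lt_k; rewrite -lp -kp !entryE dual_mx_points.
  set s := \sum_j _.
  set e := if idx p is i.+1 then entry (c^~ 0) (lab p) i ^+ q else 0.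
  have -> : (if idx p is i.+1 then entry (c^~ 0) (lab p) i else 0) ^+ q = e.
    by rewrite /e; case: (idx p) => //; apply: frobq0 g.
  have -> : (if idx p == 0%N then quot_last c (lab p) else 0) ^+ q
      = quot_last c (lab p) ^+ q *+ (idx p == 0%N).
    by case: eqP => // _; apply: frobq0 g.
  by rewrite -[_ + e - s + _]addrA opprD addrA subrr add0r opprD opprK.
rewrite leq_eqVlt => le_k.
(* Since r_l > 1, this [k] is positive, so C_t U, of degree at most 1, does not reach the
   coefficient. *)
have [k' eq_k] : exists k', k = k'.+1.
  by case: k le_k (r_gt1 l) => [|k']; [case: (r l) => [|[]] | exists k'].
rewrite eq_k in le_k *.
have out (x : 'I_N -> R) : entry x l k'.+1 = 0 
  by apply: entry_out; rewrite leq_eqVlt; exact: le_k.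
rewrite /= !out mulr0 add0r.
rewrite (frobq0 g) !subr0; case/predU1P: le_k => [eq_r|lt_r].
  have rE : r l = k'.+2 by rewrite -eq_r prednK // ltnW.
  rewrite (bigD1 l) //= big1 => [|j /negPf jl]; rewrite -rE.
    have [_ -> _] := Phi_red l l; rewrite eqxx addr0 mulrA aK mul1r rE.
    by [].
  by have [_ -> _] := Phi_red j l; rewrite jl mul0r.
rewrite entry_out // (frobq0 g) big1 // => j _.
have [_ _ ->] := Phi_red j l; first by rewrite mul0r.
by rewrite -(prednK (ltnW (r_gt1 l))).
Qed.

Lemma dual_represents delta :
  Der0 delta ->
  exists! c, Der_in Phi (carlitz g) (delta - rep dual_basis c).
Proof.
move=> delta0.
pose L (U : 'rV[tpoly g]_n) := U *m T - carlitz g 'X *m U.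
pose u k j := a j ^+ (q ^ k); pose u' k j := a' j ^+ (q ^ k).
have uK k j : u' k j * u k j = 1 by rewrite -exprMn mulrC aK expr1n.
have LB U V : L (U - V) = L U - L V.
  by rewrite /L mulmxBl mulmxBr !opprD !opprK addrACA.
have T_gt i j k : (r j < k)%N -> (T i j)`_k = 0.
  by move=> lt_k; have [_ _ ->] := Phi_red i j.
(* C_t raises degrees by at most one, which is less than [r j]; so it does not disturb the leading
   coefficients of U T. *)
have carl_gt k (U : 'rV[tpoly g]_n) :
    (forall j i, (k < i)%N -> (U 0 j)`_i = 0) ->
    forall j i, (k + r j <= i)%N -> ((carlitz g 'X *m U) 0 j)`_i = 0.
  move=> U_k j i le_i; have lt_i : (k.+1 < i)%N.
    by apply: leq_trans le_i; rewrite -addn2 leq_add2l.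
  rewrite coef_carlitz U_k ?(ltnW lt_i) // mulr0 add0r.
  by case: i lt_i {le_i} => // i lt_i; rewrite U_k // (frobq0 g).
have L_gt k (U : 'rV[tpoly g]_n) : (forall j i, (k < i)%N -> (U 0 j)`_i = 0) ->
    forall j i, (k + r j < i)%N -> (L U 0 j)`_i = 0.
  move=> U_k j i lt_i; rewrite /L coef_mxB (carl_gt _ _ U_k j i (ltnW lt_i)) subr0.
  rewrite mxE coef_skew_sum big1 // => l _.
  by apply: (coef_skewM_gt (U_k l) _ lt_i) => m; apply: T_gt.
have L_top k (U : 'rV[tpoly g]_n) : (forall j i, (k < i)%N -> (U 0 j)`_i = 0) ->
    forall j, (L U 0 j)`_(k + r j) = (U 0 j)`_k * u k j.
  move=> U_k j; rewrite /L coef_mxB (carl_gt _ _ U_k j _ (leqnn _)) subr0.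
  rewrite mxE coef_skew_sum.
  have topE l : (U 0 l * T l j)`_(k + r j) =
      (U 0 l)`_k * (a j *+ (l == j)) ^+ (q ^ k).
    rewrite (coef_skewM_top (U_k l) (fun m => T_gt l j m)).
    by have [_ -> _] := Phi_red l j.
  rewrite (eq_bigr _ (fun l _ => topE l)) (bigD1 j) //= eqxx big1 ?addr0 //.
  move=> l /negPf->; rewrite mulr0n expr0n expn_eq0.
  by rewrite eqn0Ngt (ltnW (finNzRing_gt1 F)) mulr0.
have [U U_red] := division_exists uK LB L_gt L_top delta.
have LU0 (V : 'rV[tpoly g]_n) : Der0 (L V).
  apply: Der_in_Der0 column_reduced_no_nilpotence _.
  by exists V.
pose c : 'cV[R]_N := \col_p ((delta - L U) 0 (lab p))`_(idx p).+1.
have cE : delta - rep dual_basis c = L U.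
  apply/eqP; rewrite subr_eq addrC -subr_eq; apply/eqP/matrixP => i j.
  rewrite (ord1 i) {i}; apply: skewP => k; rewrite coef_rep_dual.
  case: k => [|k].
    by have /matrixP/(_ 0 j) := Der0B delta0 (LU0 U); rewrite !mxE.
  have [lt_k|le_k] := ltnP k (r j).-1.
    by have [p [<- <-]] := slotP lt_k; rewrite entryE [RHS]mxE.
  by rewrite entry_out // U_red // -(prednK (ltnW (r_gt1 j))).
exists c; split=> [|c' [V VP]]; first by exists U.
(* Two remainders differ by L(U - V), whose [j]-th entry has degree below [r j]; uniqueness of
   division then gives U = V. *)
have cc' : rep dual_basis c' - rep dual_basis c = L (U - V).
  rewrite LB -cE /L -VP.
  by rewrite opprB [RHS]addrC addrA subrK.
have V0 : U - V = 0.
  apply: (division_unique uK L_top) => j k le_k; rewrite -cc' coef_mxB.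
  rewrite !coef_rep_dual; case: k le_k => [|k] le_k; first by rewrite subrr.
  by rewrite !entry_out ?subrr // -ltnS (prednK (ltnW (r_gt1 j))).
apply/matrixP => p i; rewrite (ord1 i) {i}; apply/esym/eqP; rewrite -subr_eq0.
have := congr1 (fun x : 'rV[tpoly g]_n => (x 0 (lab p))`_(idx p).+1) cc'.
rewrite V0 coef_mxB !coef_rep_dual !entryE => ->.
by rewrite /L mul0mx mulmx0 subrr mxE coef_skew0.
Qed.

End ColumnReduced.


(** * The double dual *)

Section Elimination.
Variables (F : finFieldType) (R : comNzRingType) (g : {rmorphism {poly F} -> R}).
Local Notation q := #|F|.

(** The joint contribution, up to sign, of C_t and of the diagonal theta of [dual_mx] to one slot.
    The constant terms cancel, so the result can be divided by tau on the right. *)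
Definition kappa (w : tpoly g) : tpoly g :=
  (tC g (g 'X) + tau g) * w - w * tC g (g 'X).

Lemma coef_kappa w k :
  (kappa w)`_k = g 'X * w`_k + (if k is i.+1 then w`_i ^+ q else 0)
                 - w`_k * g 'X ^+ (q ^ k).
Proof. by rewrite coef_skewB mulrDl coef_skewD coef_tCM coef_tauM coef_MtC. Qed.

Lemma kappa0 w : (kappa w)`_0 = 0.
Proof. by rewrite coef_kappa addr0 mulrC subrr. Qed.

Lemma kappaB w w' : kappa (w - w') = kappa w - kappa w'.
Proof. by rewrite /kappa mulrBr mulrBl !opprD !opprK addrACA. Qed.

Lemma kappa_gt k (w : tpoly g) : (forall i, (k < i)%N -> w`_i = 0) ->
  forall i, (k.+1 < i)%N -> (kappa w)`_i = 0.
Proof.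
move=> w_k [|i] // lt_i; rewrite coef_kappa !w_k ?(ltnW lt_i) //.
by rewrite mulr0 mul0r (frobq0 g) addr0 subr0.
Qed.

Lemma tau_tC a : tau g * tC g a = tC g (a ^+ q) * tau g.
Proof.
apply: skewP => -[|k]; rewrite coef_tauM coef_Mtau // !coefC.
by case: eqP => // _; apply: frobq0 g.
Qed.

Lemma kappa_tC a : kappa (tC g a) = tC g (a ^+ q) * tau g.
Proof. by rewrite /kappa mulrDl tau_tC -!rmorphM mulrC addrAC subrr add0r. Qed.

(** The quotient of right division by tau, exact when the constant term vanishes. *)
Definition shift (P : tpoly g) : tpoly g :=
  SkewPoly (frobq g) (\poly_(i < size P) P`_i.+1).

Lemma coef_shift P i : (shift P)`_i = P`_i.+1.
Proof.
rewrite coef_poly; case: ltnP => // le_i.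
by rewrite nth_default // (leq_trans le_i).
Qed.

Lemma shiftB P Q : shift (P - Q) = shift P - shift Q.
Proof. by apply: skewP => i; rewrite coef_skewB !coef_shift coef_skewB. Qed.

Lemma shiftK (P : tpoly g) : P`_0 = 0 -> shift P * tau g = P.
Proof. by move=> P0; apply: skewP => -[|i]; rewrite coef_Mtau ?coef_shift. Qed.

Lemma shift_Mtau P : shift (P * tau g) = P.
Proof. by apply: skewP => i; rewrite coef_shift coef_Mtau. Qed.

(* Solves W_(i+1) tau - kappa W_i = V_i recursively, from W_0 = X. *)
Fixpoint elim_seq (V : nat -> tpoly g) (X : tpoly g) (i : nat) : tpoly g :=
  if i is i'.+1 then shift (V i' + kappa (elim_seq V X i')) else X.

Lemma elim_seqS V X i :
  elim_seq V X i.+1 = shift (V i + kappa (elim_seq V X i)).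
Proof. by []. Qed.

Lemma elim_seqB X Y i :
  elim_seq (fun=> 0) (X - Y) i =
  elim_seq (fun=> 0) X i - elim_seq (fun=> 0) Y i.
Proof. by elim: i => // i IHi; rewrite !elim_seqS IHi !add0r kappaB shiftB. Qed.

(** [kappa] raises the degree by at most one and [shift] lowers it by one, so no entry of the chain
    exceeds the degree bound of its start [X]. *)
Lemma elim_seq_gt k (X : tpoly g) : (forall i, (k < i)%N -> X`_i = 0) ->
  forall m i, (k < i)%N -> (elim_seq (fun=> 0) X m)`_i = 0.
Proof.
move=> X_k; elim=> // m IHm i lt_i; rewrite elim_seqS.
by rewrite coef_shift add0r (kappa_gt IHm).
Qed.

Lemma eq_elim_seq V V' X i : V =1 V' -> elim_seq V X i = elim_seq V' X i.
Proof. by move=> eqV; elim: i => // i IHi; rewrite !elim_seqS IHi eqV. Qed.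

Lemma coef_Mtau2 (P : tpoly g) i :
  (P * tau g ^+ 2)`_i = if i is k.+2 then P`_k else 0.
Proof. by rewrite expr2 mulrA coef_Mtau; case: i => // i; rewrite coef_Mtau. Qed.

End Elimination.

Lemma tdiff_dual_mx (F : finFieldType) (R : comNzRingType)
    (g : {rmorphism {poly F} -> R}) n (r : 'I_n -> nat) (a' : 'I_n -> R)
    (T : 'M[tpoly g]_n) :
  map_mx (tdiff g) (dual_mx r a' T) = (g 'X)%:M.
Proof.
apply/matrixP => p' p; rewrite !mxE /tdiff !coef_skewD.
by rewrite coef_Mtau coef_Mtau2 coefC !addr0.
Qed.

Section DualOfDual.
Variables (F : finFieldType) (R : comNzRingType) (g : {rmorphism {poly F} -> R}).
Variables (n : nat) (r : 'I_n -> nat) (a a' : 'I_n -> R).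
Hypothesis aK : forall j, a j * a' j = 1.
Hypothesis r_gt1 : forall l, (1 < r l)%N.
Variable T : 'M[tpoly g]_n.
Hypothesis T_red : column_reduced r a T.
Local Notation q := #|F|.
Local Notation N := #|{: slot r}|.
Variable D : tmodule g N.
Hypothesis DX : D 'X = dual_mx r a' T.

(** The contribution to the last slot of block [j] from the last column of that block in [dual_mx],
    the diagonal theta excepted. *)
Definition last_part (W : 'rV[tpoly g]_N) j : tpoly g :=
  entry (W 0) j 0 * tC g (a' j ^+ q) * tau g ^+ 2
  - \sum_l \sum_(h < (r l).-1)
      entry (W 0) l h * tC g ((T j l)`_h.+1 * a' j) * tau g.

Fact inner_row_key : unit. Proof. by []. Qed.

(** Locked so that unification does not unfold the matrix products. *)
Definition inner_row : 'rV[tpoly g]_N -> 'rV[tpoly g]_N :=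
  locked_with inner_row_key (fun W => W *m D 'X - carlitz g 'X *m W).
Local Notation L := inner_row.

Lemma inner_rowE W : L W = W *m D 'X - carlitz g 'X *m W.
Proof. by rewrite /L locked_withE. Qed.

Lemma inner_rowB W W' : L (W - W') = L W - L W'.
Proof. by rewrite !inner_rowE mulmxBl mulmxBr !opprD !opprK addrACA. Qed.

(** Away from the last slot of a block, only the next entry times tau and [kappa] of the current one
    occur; this is what makes the recursive elimination possible. *)
Lemma inner_row_entry (W : 'rV[tpoly g]_N) p :
  L W 0 p = entry (W 0) (lab p) (idx p).+1 * tau g - kappa (W 0 p)
            + last_part W (lab p) *+ ((idx p).+2 == r (lab p)).
Proof.
pose last := (idx p).+2 == r (lab p); pose j := lab p.
have WD : (W *m D 'X) 0 p = W 0 p * tC g (g 'X)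
   + entry (W 0) j (idx p).+1 * tau g + last_part W j *+ last.
  rewrite DX mxE.
  under eq_bigr => s _ do rewrite mxE !mulrDr -/j -/last !mulrA !rmorphB mulrBr
    mulrBl !rmorphMn /= !mulrnAr !mulrnAl.
  rewrite !big_split /= -!addrA; congr (_ + _).
    rewrite (bigD1 p) //= eqxx big1 ?addr0 // => s /negPf ne_s.
    by rewrite ne_s.
  rewrite sumrN; congr (_ + _).
    rewrite -(sum_slot_pick (W 0)) mulr_suml; apply: eq_bigr => s _.
    by rewrite rmorph1 mulr1 mulrnAl.
  rewrite addrC /last_part mulrnBl; congr (_ - _); last first.
    rewrite sumrMnl; congr (_ *+ _).
    exact: (sum_entry (W 0)
      (fun l h w => w * tC g ((T j l)`_h.+1 * a' j) * tau g)).
  rewrite sumrMnl; congr (_ *+ _).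
  rewrite -(sum_slot_pick (W 0)) !mulr_suml; apply: eq_bigr => s _.
  by rewrite expr2 !mulrA !mulrnAl.
have subE (x y : 'rV[tpoly g]_N) : (x - y) 0 p = x 0 p - y 0 p by rewrite !mxE.
rewrite inner_rowE subE WD carlitzX mul_scalar_mx mxE -/(kappa _) -/j -/last.
by rewrite /kappa opprB [W 0 p * _ + _]addrC -!addrA [in X in _ + (_ + X)]addrC.
Qed.

Definition elim_row (V : 'rV[tpoly g]_N) (X : 'rV[tpoly g]_n) :
    'rV[tpoly g]_N :=
  \row_p elim_seq (entry (V 0) (lab p)) (X 0 (lab p)) (idx p).

Lemma entry_row (f : 'I_n -> nat -> tpoly g) j i : (i < (r j).-1)%N ->
  entry ((\row_p f (lab p) (idx p) : 'rV[tpoly g]_N) 0) j i = f j i.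
Proof. by move=> /slotP[p [<- <-]]; rewrite entryE mxE. Qed.

Lemma not_last (p : 'I_N) :
  (idx p).+2 != r (lab p) -> ((idx p).+1 < (r (lab p)).-1)%N.
Proof.
move=> ne_p; rewrite ltn_neqAle idx_lt andbT -eqSS.
by rewrite prednK // ltnW.
Qed.

(** The absence of a constant term in [V] makes every right division by tau in the recursion
    exact. *)
Lemma inner_elim_row (V : 'rV[tpoly g]_N) X (p : 'I_N) :
  (V 0 p)`_0 = 0 -> (idx p).+2 != r (lab p) ->
  L (elim_row V X) 0 p = V 0 p.
Proof.
move=> V0 ne_p; rewrite inner_row_entry (negPf ne_p) mulr0n addr0.
rewrite (entry_row (fun j => elim_seq (entry (V 0) j) (X 0 j))) ?not_last //.
by rewrite elim_seqS entryE mxE shiftK ?addrK // coef_skewD V0 kappa0 addr0.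
Qed.

Lemma elim_row0E X (p : 'I_N) :
  elim_row 0 X 0 p = elim_seq (fun=> 0) (X 0 (lab p)) (idx p).
Proof.
rewrite mxE; apply: eq_elim_seq => i.
by rewrite /entry; case: insub => // o; rewrite mxE.
Qed.

(** Right multiplication by tau is injective, so the homogeneous equations recover each block from
    its first slot. *)
Lemma elim_row_unique (W : 'rV[tpoly g]_N) :
    (forall p : 'I_N, (idx p).+2 != r (lab p) -> L W 0 p = 0) ->
  W = elim_row 0 (\row_j entry (W 0) j 0).
Proof.
move=> LW; apply/matrixP => i p; rewrite (ord1 i) {i}.
suff H m : (m < (r (lab p)).-1)%N ->
    entry (W 0) (lab p) m = elim_seq (fun=> 0) (entry (W 0) (lab p) 0) m.
  by rewrite -(entryE (W 0)) (H _ (idx_lt p)) elim_row0E mxE.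
elim: m => // m IHm lt_m; have [p' [lp mp]] := slotP (ltnW lt_m).
have lt_r : (m.+2 < r (lab p))%N by rewrite -ltn_predRL.
have := LW p'; rewrite inner_row_entry lp mp (ltn_eqF lt_r) mulr0n addr0.
move=> /(_ isT)/eqP.
rewrite subr_eq0 -(entryE (W 0) p') lp mp IHm ?(ltnW lt_m) // => /eqP eqW.
by rewrite elim_seqS add0r -eqW shift_Mtau.
Qed.

(** The factor [a' j] normalises the coordinates so that t acts by [T] itself, not merely by a
    conjugate. *)
Definition bidual_basis : 'M[tpoly g]_(n, N) :=
  \matrix_(j, p) (tC g (a' j) * tau g *+ ((lab p == j) && ((idx p).+2 == r j))).

Lemma rep_bidual y p :
  rep bidual_basis y 0 p =
  tC g (y (lab p) 0 * a' (lab p)) * tau g *+ ((idx p).+2 == r (lab p)).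
Proof.
rewrite repE mxE (bigD1 (lab p)) //= big1 => [|j]; last first.
  by rewrite !mxE eq_sym => /negPf->; rewrite mulr0.
by rewrite !mxE eqxx addr0 mulrnAr mulrA rmorphM.
Qed.

Lemma Der0_bidual_basis : Der0 bidual_basis.
Proof.
apply/matrixP => j p; rewrite !mxE; case: andP => _; rewrite ?mulr0n ?raddf0 //.
by rewrite mulr1n /tdiff coef_Mtau.
Qed.

Lemma teval_reduced j l x :
  teval (T j l) x = g 'X * x *+ (j == l)
    + \sum_(h < (r l).-1) (T j l)`_h.+1 * x ^+ (q ^ h.+1)
    + a l * x ^+ (q ^ r l) *+ (j == l).
Proof.
have [T0 Tr T_gt] := T_red j l.
rewrite (@tevalE _ _ _ (r l).+1); last by apply/leq_sizeP => k; apply: T_gt.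
rewrite big_ord_recl T0 expr1 mulrnAl -addrA; congr (_ + _).
case: (r l) (r_gt1 l) Tr => // m _ Tr.
by rewrite big_ord_recr /= /bump /= add1n Tr mulrnAl.
Qed.

Lemma mx_points_reduced (y : 'cV_n) j :
  mx_points T y j 0 = g 'X * y j 0
    + \sum_l \sum_(h < (r l).-1) (T j l)`_h.+1 * y l 0 ^+ (q ^ h.+1)
    + a j * y j 0 ^+ (q ^ r j).
Proof.
rewrite mxE (eq_bigr _ (fun l _ => teval_reduced j l (y l 0))) !big_split /=.
congr (_ + _ + _); rewrite (bigD1 j) //= eqxx big1 ?addr0 // => l /negPf.
  by rewrite eq_sym => ->.
by rewrite eq_sym => ->.
Qed.

Lemma bidual_action y :
  Der_in D (carlitz g) (carlitz g 'X *m rep bidual_basis y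
    - rep bidual_basis (mx_points T y)).
Proof.
(* This row solves the equations away from the last slots, since kappa(c) = c^q tau for a constant
   c. *)
pose f j i : tpoly g := tC g (y j 0 ^+ (q ^ i.+1)).
exists (\row_p f (lab p) (idx p)); apply/matrixP => i p; rewrite (ord1 i) {i}.
have subE (x z : 'rV[tpoly g]_N) : (x - z) 0 p = x 0 p - z 0 p by rewrite !mxE.
rewrite -inner_rowE inner_row_entry [X in kappa X]mxE subE carlitzX mul_scalar_mx.
rewrite [X in X - _]mxE !rep_bidual kappa_tC -exprM -expnSr.
have [last|ne_last] := eqVneq (idx p).+2 (r (lab p)); last first.
  by rewrite !mulr0n mulr0 subrr addr0 entry_row ?not_last // subrr.
(* In the last slot there is no successor, and -kappa leaves -y_j^(q^(r_j)) tau: the leading term of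
   [T] at y, multiplied by a_j^-1. *)
rewrite !mulr1n entry_out; last by rewrite -ltnS -last prednK.
rewrite mul0r sub0r last /last_part entry_row; last first.
  exact: leq_ltn_trans (leq0n _) (idx_lt p).
rewrite (eq_bigr (fun l => \sum_(h < (r l).-1) tC g (y l 0 ^+ (q ^ h.+1)
    * ((T (lab p) l)`_h.+1 * a' (lab p))) * tau g)) => [|l _]; last first.
  by apply: eq_bigr => h _; rewrite (entry_row f) // /f -rmorphM.
under eq_bigr do rewrite -mulr_suml -rmorph_sum.
rewrite -mulr_suml -rmorph_sum mx_points_reduced /f expn1.
set j := lab p; set Y := y j 0; set S := \sum_l _; set S' := \sum_l _.
have S'E : S' = S * a' j.
  rewrite mulr_suml; apply: eq_bigr => l _; rewrite mulr_suml.
  by apply: eq_bigr => h _; rewrite mulrCA mulrA.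
have -> : (g 'X * Y + S + a j * Y ^+ (q ^ r j)) * a' j =
    g 'X * (Y * a' j) + S' + Y ^+ (q ^ r j).
  by rewrite S'E !mulrDl [a j * _ * _]mulrAC aK mul1r mulrA.
have -> : (tC g (g 'X) + tau g) * (tC g (Y * a' j) * tau g) =
    tC g (g 'X * (Y * a' j)) * tau g
    + tC g (Y ^+ q) * tC g (a' j ^+ q) * tau g ^+ 2.
  rewrite mulrDl [tC g (g 'X) * _]mulrA -rmorphM; congr (_ + _).
  by rewrite mulrA tau_tC exprMn rmorphM -mulrA -expr2.
rewrite !rmorphD !mulrDl /=.
have addE (M : zmodType) (x b s c : M) : x + b - (x + s + c) = - c + (b - s).
  by rewrite -(addrA x s) opprD addrA (addrC x) addrK opprD addrA addrC.
exact: addE.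
Qed.

Lemma dual_mx_no_nilpotence : no_nilpotence D.
Proof. by rewrite /no_nilpotence DX tdiff_dual_mx. Qed.

Let last_col (W : 'rV[tpoly g]_N) : 'rV[tpoly g]_n :=
  \row_j entry (W 0) j (r j).-2.

Lemma last_colE W (p : 'I_N) :
  (idx p).+2 = r (lab p) -> last_col W 0 (lab p) = W 0 p.
Proof. by move=> last; rewrite mxE -last entryE. Qed.

Lemma last_slotP j : exists p : 'I_N, lab p = j /\ (idx p).+2 = r j.
Proof.
have [p [<- ip]] := slotP (last_lt r_gt1 j); exists p; split=> //.
by apply/eqP; rewrite last_slotE // ip.
Qed.

(** The remaining equations, one for each block, as an operator on the entries [X] in the first
    slots. *)
Let M X := last_col (L (elim_row 0 X)).

(** Both [kappa] and the terms with coefficients of [T] have degree at most k + 1 here; above that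
    only the tau^2 term of [last_part] survives. *)
Lemma coef_last_col k (X : 'rV[tpoly g]_n) j i :
    (forall j i, (k < i)%N -> (X 0 j)`_i = 0) -> (k.+1 < i)%N ->
  (M X 0 j)`_i =
  if i is i'.+2 then (X 0 j)`_i' * (a' j ^+ q) ^+ (q ^ i') else 0.
Proof.
move=> X_k lt_i; have [p [<- last]] := last_slotP j.
rewrite /M (last_colE _ last) inner_row_entry last eqxx mulr1n entry_out; last first.
  by rewrite -ltnS -last prednK // ltnW.
rewrite mul0r sub0r coef_skewD coef_skewN elim_row0E.
rewrite (kappa_gt (elim_seq_gt (X_k _) _)) // oppr0 add0r coef_skewB.
have row_entry l h : (h < (r l).-1)%N ->
    entry (elim_row 0 X 0) l h = elim_seq (fun=> 0) (X 0 l) h.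
  by move=> /slotP[s [<- <-]]; rewrite entryE elim_row0E.
rewrite row_entry ?(leq_ltn_trans (leq0n _) (idx_lt p)) // coef_Mtau2.
rewrite coef_skew_sum big1 ?subr0 => [|l _].
  by case: i lt_i => [|[|i]] // _; rewrite coef_MtC.
rewrite coef_skew_sum big1 // => h _; rewrite row_entry // coef_Mtau.
case: i lt_i => // i lt_i; rewrite coef_MtC (elim_seq_gt (X_k _)) ?mul0r //.
Qed.

Lemma bidual_represents V :
  Der0 V -> exists! y, Der_in D (carlitz g) (V - rep bidual_basis y).
Proof.
move=> /matrixP V0.
have subE d (x z : 'rV[tpoly g]_d) p : (x - z) 0 p = x 0 p - z 0 p.
  by rewrite !mxE.
have V0p (p : 'I_N) : (V 0 p)`_0 = 0 by have := V0 0 p; rewrite !mxE.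
have L0 (W : 'rV[tpoly g]_N) p : (L W 0 p)`_0 = 0.
  have := Der_in_Der0 dual_mx_no_nilpotence (ex_intro _ W (inner_rowE W)).
  by move/matrixP/(_ 0 p); rewrite mxE [in RHS]mxE.
have elimB X Y : elim_row 0 (X - Y) = elim_row 0 X - elim_row 0 Y.
  apply/matrixP => i p; rewrite (ord1 i) subE !elim_row0E subE.
  exact: elim_seqB.
pose u k j := (a' j ^+ q) ^+ (q ^ k); pose u' k j := (a j ^+ q) ^+ (q ^ k).
have uK k j : u' k j * u k j = 1 by rewrite -!exprMn aK !expr1n.
have MB X Y : M (X - Y) = M X - M Y.
  apply/matrixP => i j; rewrite (ord1 i) {i}; have [p [<- last]] := last_slotP j.
  rewrite [RHS]subE.
  rewrite /M.
  rewrite [LHS](last_colE _ last).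
  rewrite [X in _ = X - _](last_colE _ last).
  rewrite [X in _ = _ - X](last_colE _ last).
  rewrite elimB.
  rewrite inner_rowB; apply: subE.
have M_gt k (X : 'rV[tpoly g]_n) : (forall j i, (k < i)%N -> (X 0 j)`_i = 0) ->
    forall j i, (k + 2 < i)%N -> (M X 0 j)`_i = 0.
  move=> X_k j i; rewrite addn2 => lt_i.
  rewrite (coef_last_col _ X_k) ?(ltnW lt_i) //.
  by case: i lt_i => [|[|i]] // lt_i; rewrite X_k ?mul0r.
have M_top k (X : 'rV[tpoly g]_n) : (forall j i, (k < i)%N -> (X 0 j)`_i = 0) ->
    forall j, (M X 0 j)`_(k + 2) = (X 0 j)`_k * u k j.
  by move=> X_k j; rewrite addn2 (coef_last_col _ X_k).
(* [W0] settles all equations but the last ones; adding a homogeneous chain [elim_row 0 X] keeps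
   them settled, so [X] is free for the division in the last slots. *)
pose W0 := elim_row V 0.
have [X X_red] :=
  division_exists (e := fun=> 2%N) uK MB M_gt M_top (last_col (V - L W0)).
pose rho := last_col (V - L W0) - M X.
have rhoE (p : 'I_N) : (idx p).+2 = r (lab p) ->
    rho 0 (lab p) = V 0 p - L W0 0 p - L (elim_row 0 X) 0 p.
  move=> last; rewrite /rho subE /M.
  rewrite [X in X - _](last_colE _ last) [X in _ - X](last_colE _ last).
  by rewrite [X in X - _]subE.
(* The remainder has degree below 2 and no constant term, hence is a multiple of tau. *)
have rho_tau j : rho 0 j = tC g (rho 0 j)`_1 * tau g.
  apply: skewP => -[|[|i]]; rewrite coef_Mtau ?coefC ?eqxx //; last exact: X_red.
  have [p [<- last]] := last_slotP j.
  by rewrite (rhoE _ last) !coef_skewB V0p !L0 !subr0.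
pose y : 'cV[R]_n := \col_j (a j * (rho 0 j)`_1).
have yE : V - rep bidual_basis y = L (W0 + elim_row 0 X).
  have -> : L (W0 + elim_row 0 X) = L W0 + L (elim_row 0 X).
    by rewrite !inner_rowE mulmxDl mulmxDr opprD addrACA.
  apply/matrixP => i p; rewrite (ord1 i) {i} [LHS]subE [RHS]mxE rep_bidual.
  have [last|ne_last] := eqVneq (idx p).+2 (r (lab p)); last first.
    rewrite mulr0n subr0 (inner_elim_row _ (V0p p) ne_last).
    by rewrite inner_elim_row ?mxE ?coef_skew0 // addr0.
  rewrite mulr1n mxE mulrAC aK mul1r -rho_tau (rhoE _ last).
  by rewrite -addrA -opprD subKr.
exists y; split=> [|y' [W' eqW']].
  by exists (W0 + elim_row 0 X); rewrite yE inner_rowE.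
have yy' : rep bidual_basis (y' - y) = L (W0 + elim_row 0 X - W').
  rewrite inner_rowB -yE [L W']inner_rowE -eqW' repB.
  by rewrite opprB [RHS]addrC addrA subrK.
move: (_ - W') yy' => Z yy'.
(* Away from the last slots [Z] solves the homogeneous equations, so it is a chain; in the last
   slots the remainder has degree below 2, and uniqueness of division kills its start. *)
have Z0 : Z = 0.
  have : Z = elim_row 0 (\row_j entry (Z 0) j 0).
    apply: elim_row_unique => p ne_p.
    by rewrite -yy' rep_bidual (negPf ne_p).
  set X' := \row_j _ => ZE; rewrite ZE.
  suff -> : X' = 0 by have := elimB 0 0; rewrite !subrr.
  apply: (division_unique (e := fun=> 2%N) uK M_top) => j k le_k.
  have [p [<- last]] := last_slotP j.
  rewrite /M (last_colE _ last) -ZE -yy' rep_bidual last eqxx mulr1n coef_Mtau.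
  by case: k le_k => [|[|k]] // _; rewrite coefC.
apply/eqP; rewrite eq_sym -subr_eq0; apply/eqP/matrixP => j i; rewrite (ord1 i).
have [p [<- last]] := last_slotP j.
have := congr1 (fun P : tpoly g => P`_1) (rep_bidual (y' - y) p).
rewrite yy' Z0 inner_rowE mul0mx mulmx0 subrr mxE coef_skew0 last eqxx mulr1n.
rewrite coef_Mtau coefC eqxx => /(congr1 ( *%R (a (lab p)))).
by rewrite mulr0 mulrCA aK mulr1 => <-; rewrite mxE.
Qed.

End DualOfDual.


(** * The explicit dual and double dual as structures over all base rings *)

Section ExplicitDuals.
Variables (F : finFieldType) (R : comNzRingType) (g : {rmorphism {poly F} -> R}).
Variables (n : nat) (r : 'I_n -> nat) (a a' : 'I_n -> R).
Hypothesis aK : forall j, a j * a' j = 1.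
Hypothesis r_gt1 : forall l, (1 < r l)%N.
Variable Phi : tmodule g n.
Hypothesis Phi_red : column_reduced r a (Phi 'X).
Local Notation q := #|F|.
Local Notation N := #|{: slot r}|.
Variable D : tmodule g N.
Hypothesis DX : D 'X = dual_mx r a' (Phi 'X).

Section BaseChange.
Variables (S : comNzRingType) (f : {rmorphism R -> S}).

Lemma inverse_base j : (f \o a) j * (f \o a') j = 1.
Proof. by rewrite -rmorphM aK rmorph1. Qed.

Lemma column_reduced_base : column_reduced r (f \o a) (tm_base f Phi 'X).
Proof.
move=> i j; have [T0 Tr T_gt] := Phi_red i j.
rewrite /= mxE !coef_tmap T0 Tr !rmorphMn; split=> // k lt_k.
by rewrite coef_tmap T_gt ?rmorph0.
Qed.

Lemma dual_basis_base : map_mx (tmap g f) (dual_basis g r) = dual_basis _ r.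
Proof.
by apply/matrixP => p j; rewrite !mxE rmorphMn rmorphXn /= tmap_tau.
Qed.

Lemma dual_mx_base :
  map_mx (tmap g f) (dual_mx r a' (Phi 'X)) =
  dual_mx r (f \o a') (tm_base f Phi 'X).
Proof.
apply/matrixP => p' p; rewrite !mxE !(rmorphD (tmap g f)) expr2.
rewrite !(rmorphM (tmap g f)) /= !tmap_tC tmap_tau.
congr (_ + _ + _); last by rewrite !rmorphMn rmorphXn.
  by rewrite rmorphMn.
by rewrite rmorphB rmorph_nat rmorphMn rmorphM /= coef_tmap.
Qed.

Lemma bidual_basis_base :
  map_mx (tmap g f) (bidual_basis g r a') = bidual_basis _ r (f \o a').
Proof.
by apply/matrixP => j p; rewrite !mxE rmorphMn rmorphM /= tmap_tC tmap_tau.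
Qed.

End BaseChange.

Lemma dual_z_structure : z_structure true Phi (dual_basis g r) (D 'X).
Proof.
have nilPhi := column_reduced_no_nilpotence Phi_red.
split; first split=> [_|S f delta /(_ isT) delta0].
- exact: Der0_dual_basis.
- have [c [ic uniq_c]] :=
    dual_represents (inverse_base f) r_gt1 (column_reduced_base f) delta0.
  exists c; split=> [|c' [ic' _]].
    rewrite Der_repE dual_basis_base.
    by apply: Der_in_inner ic; apply: no_nilpotence_base.
  by apply: uniq_c; rewrite Der_repE dual_basis_base in ic'.
move=> S f c; rewrite !Der_repE dual_basis_base DX dual_mx_base.
apply: Der_in_inner; first exact: no_nilpotence_base.
exact: (dual_action (inverse_base f) r_gt1 (column_reduced_base f)).
Qed.

Lemma bidual_z_structure : z_structure true D (bidual_basis g r a') (Phi 'X).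
Proof.
have nilD := dual_mx_no_nilpotence DX.
have DXS (S : comNzRingType) (f : {rmorphism R -> S}) :
    tm_base f D 'X = dual_mx r (f \o a') (tm_base f Phi 'X).
  by rewrite -dual_mx_base -DX.
split; first split=> [_|S f delta /(_ isT) delta0].
- exact: Der0_bidual_basis.
- have [c [ic uniq_c]] := bidual_represents (inverse_base f) r_gt1 (DXS S f) delta0.
  exists c; split=> [|c' [ic' _]].
    rewrite Der_repE bidual_basis_base.
    by apply: Der_in_inner ic; apply: no_nilpotence_base.
  by apply: uniq_c; rewrite Der_repE bidual_basis_base in ic'.
move=> S f c; rewrite !Der_repE bidual_basis_base.
apply: Der_in_inner; first exact: no_nilpotence_base.
exact: (bidual_action (inverse_base f) r_gt1 (column_reduced_base f) (DXS S f)).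
Qed.

End ExplicitDuals.

Section StructurePredicates.
Variables (F : finFieldType) (R : comNzRingType) (g : {rmorphism {poly F} -> R}).

Lemma Ext_structureP d m (Phi : tmodule g d) (E : tmodule g m) :
  Ext_structure Phi E <-> exists b, z_structure false Phi b (E 'X).
Proof.
split=> [[b bE]|[b [[_ rb] bE]]]; exists b.
  split; first split=> [//|S f delta _].
    have [c [ic uniq_c]] := (bE S f).1 delta.
    exists c; split=> [|c' [ic' _]]; last exact: uniq_c ic'.
    by split; first exact: ic.
  by move=> S f c; split; first exact: (bE S f).2.
move=> S f; split=> [delta|c]; last exact: (bE S f c).1.
have [//|c [[ic _] uniq_c]] := rb S f delta.
exists c; split=> [|c' ic']; first exact: ic.
by apply: uniq_c; split; first exact: ic'.
Qed.

Lemma dual_structureP d m (Phi : tmodule g d) (D : tmodule g m) :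
  dual_structure Phi D <-> exists b, z_structure true Phi b (D 'X).
Proof.
split=> [[b [b0 bD]]|[b [[b0 rb] bD]]]; exists b.
  split; first split=> [_|S f delta delta0]; first exact: b0.
    have [c [[ic ic0] uniq_c]] := (bD S f).1 delta (delta0 isT).
    exists c; split=> [|c' [ic' ic0']].
      by split=> [|_]; [exact: ic | exact: ic0].
    by apply: uniq_c; split; [exact: ic' | exact: ic0'].
  move=> S f c; have [ic ic0] := (bD S f).2 c.
  by split=> [|_]; [exact: ic | exact: ic0].
split=> [|S f]; first exact: b0.
split=> [delta delta0|c]; last first.
  by have [ic ic0] := bD S f c; split; [exact: ic | exact: ic0].
have [//|c [[ic ic0] uniq_c]] := rb S f delta.
exists c; split=> [|c' [ic' ic0']]; first by split; [exact: ic | exact: ic0].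
by apply: uniq_c; split=> [|_]; [exact: ic' | exact: ic0'].
Qed.

End StructurePredicates.

(** * Reduced triangular modules and the conclusion *)

Section ReducedTriangular.
Variables (F : finFieldType) (K : fieldType) (g : {rmorphism {poly F} -> K}).

Lemma coef_drinfeld (a : nat -> K) r k : (0 < k)%N ->
  (tC g (g 'X) + \sum_(1 <= i < r.+1) tC g (a i) * tau g ^+ i)`_k =
  a k *+ (k <= r)%N.
Proof.
move=> k_gt0; rewrite coef_skewD coefC gtn_eqF // add0r coef_skew_sum.
under eq_bigr do rewrite coef_tCM coef_tau_exp mulr_natr.
have [le_k|lt_k] := leqP k r; last first.
  rewrite big_nat_cond big1 // => i; rewrite andbT => /andP[_ le_i].
  by rewrite gtn_eqF // (leq_trans le_i).
rewrite (bigD1_seq k) /= ?iota_uniq ?mem_index_iota ?k_gt0 ?ltnS //.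
by rewrite eqxx big1 ?addr0 // => i; rewrite eq_sym => /negPf->.
Qed.

(** The LD bound on sizes means degree strictly below the rank, so off-diagonal entries vanish
    already at that degree, while the diagonal has the leading coefficients of the Drinfeld modules.
    Positions run against labels, hence [rev_ord]. *)
Lemma column_reduced_triangular n (r : 'I_n -> nat) (psi : 'I_n -> tmodule g 1)
    (delta : 'I_n -> 'I_n -> tpoly g) (Ups : tmodule g n) :
    triangular r psi delta Ups -> LD_bound r delta -> no_nilpotence Ups ->
  exists a a' : 'I_n -> K, (forall j, a j * a' j = 1) /\
    column_reduced (r \o @rev_ord n) a (Ups 'X).
Proof.
move=> [drin UpsX] LD /matrixP nilUps.
have /fin_all_exists[a aP] l : exists a : nat -> K, a (r l) != 0 /\
    psi l 'X = (tC g (g 'X) + \sum_(1 <= i < (r l).+1) tC g (a i) * tau g ^+ i)%:M.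
  by have [_] := drin l.
exists (fun j => a (rev_ord j) (r (rev_ord j))).
exists (fun j => (a (rev_ord j) (r (rev_ord j)))^-1).
split=> [j|i j]; first by rewrite mulfV // (aP _).1.
have r_gt0 : (0 < r (rev_ord j))%N by have [] := drin (rev_ord j).
rewrite -[(Ups 'X i j)`_0]/(tdiff g (Ups 'X i j)).
have -> : tdiff g (Ups 'X i j) = g 'X *+ (i == j).
  by have := nilUps i j; rewrite mxE => ->; rewrite mxE.
have -> : Ups 'X i j = triangular_mx psi delta i j by rewrite UpsX.
rewrite mxE /= (inj_eq rev_ord_inj).
case: eqP => [<-|_]; last first.
  case: ifP => [lt_ij|_]; last by split=> // *; rewrite coef_skew0.
  have le_size : (size (delta (rev_ord i) (rev_ord j)) <= r (rev_ord j))%N.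
    by apply: leq_trans (LD (rev_ord j)); apply: (bigmax_sup (rev_ord i)).
  split=> // [|k lt_k]; rewrite nth_default //.
  exact: leq_trans le_size (ltnW lt_k).
rewrite (aP _).2 mxE eqxx mulr1n.
split=> // [|k lt_k]; rewrite coef_drinfeld //.
- by rewrite leqnn.
- by have [] := drin (rev_ord i).
- by rewrite leqNgt lt_k.
exact: leq_ltn_trans (leq0n _) lt_k.
Qed.

End ReducedTriangular.

Theorem theorem9p5 (F : finFieldType) (K : fieldType)
    (g : {rmorphism {poly F} -> K}) (n : nat) (r : 'I_n -> nat)
    (psi : 'I_n -> tmodule g 1) (delta : 'I_n -> 'I_n -> tpoly g)
    (Ups : tmodule g n) (L : fieldExtType K)
    (hUps : triangular r psi delta Ups) (hnil : no_nilpotence Ups)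
    (hr : forall l, (1 < r l)%N) (hLD : LD_over r Ups L) :
  let UpsL := tm_base (GRing.in_alg L) Ups in
  (exists (d : nat) (D : tmodule (base_ext g L) d), dual_structure UpsL D) /\
  forall (d : nat) (D : tmodule (base_ext g L) d), dual_structure UpsL D ->
    [/\ exists (d' : nat) (DD : tmodule (base_ext g L) d'), dual_structure D DD,
        forall (d' : nat) (DD : tmodule (base_ext g L) d'),
          dual_structure D DD -> tm_iso DD UpsL,
        exists (m : nat) (E : tmodule (base_ext g L) m), Ext_structure D E
      & forall (m : nat) (E : tmodule (base_ext g L) m), Ext_structure D E ->
          tm_exact UpsL E (Ga (base_ext g L) (\sum_(l < n) r l - n)%N)].
Proof.
move=> UpsL.
have nilU : no_nilpotence UpsL := no_nilpotence_base _ hnil.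
have [psi' [delta' [Red [triR _ isoU LD]]]] := hLD.
have nilR := no_nilpotence_iso isoU nilU.
have [a [a' [aK redR]]] := column_reduced_triangular triR LD nilR.
have s_gt1 j : (1 < (r \o @rev_ord n) j)%N by apply: hr.
pose T := dual_mx (r \o @rev_ord n) a' (Red 'X).
have T_tangent : tangent T.
  exists 0; split; first by exists 1%N; rewrite expr1.
  by rewrite addr0 tdiff_dual_mx.
pose D0 := tmodule_of T_tangent.
have D0X : D0 'X = T := tm_evalX T.
have nilD0 := dual_mx_no_nilpotence D0X.
have bR := dual_z_structure aK s_gt1 redR D0X.
have bD0 := bidual_z_structure aK s_gt1 redR D0X.
have [E0 [[bE0 bE0P] exE0]] := Ext_of_dual nilD0 nilR bD0.
have [bU bUP] := z_structure_iso (tm_iso_sym isoU) bR.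
split=> [|d D /dual_structureP[b bD]].
  by exists _, D0; apply/dual_structureP; exists bU.
(* Every dual of [UpsL] is isomorphic to the explicit [D0], so the double dual and Ext^1 computed
   for [D0] carry over to it. *)
have isoD := z_structure_unique bUP bD.
have [bDD bDDP] := z_structure_iso isoD bD0.
have [bE bEP] := z_structure_iso isoD bE0P.
split.
- by exists _, Red; apply/dual_structureP; exists bDD.
- move=> d' DD /dual_structureP[c cDD].
  exact: tm_iso_trans (z_structure_unique cDD bDDP) (tm_iso_sym isoU).
- by exists _, E0; apply/Ext_structureP; exists bE.
move=> m E /Ext_structureP[c cE].
have -> : (\sum_(l < n) r l - n)%N = #|{: slot (r \o @rev_ord n)}|.
  by rewrite (card_slot s_gt1) (reindex_inj rev_ord_inj).
exact: tm_exact_iso (tm_iso_sym isoU) (z_structure_unique bEP cE) exE0.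
Qed.
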